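(* Let $V$ be a $\mathbb{Z}^n$-graded vector space. The $\mathbb{Z}^{n+1}$-graded vector space $M_r(V)$ is a $\mathbb{Z}^{n+1}$-graded Lie algebra when endowed with the bracket $$[A,B]^{\otimes}:=(-1)^{1+\langle ae_1,be_1+B\rangle}\,\phi^{-1}_{(A+B,a+b)}\big([\phi_{(A,a)}(A),\phi_{(B,b)}(B)]\big),$$ $A\in M^{(A,a)}(V)$, $B\in M^{(B,b)}(V)$, where $[-,-]$ denotes the $\mathbb{Z}^n$-graded Lie bracket (graded commutator) of the space of coderivations of $(T(\downarrow V),\Delta)$.
   Context: Vector spaces are over a field $\mathbb{K}$ of characteristic $0$; for $\alpha,\beta\in\mathbb{Z}^m$, $\langle\alpha,\beta\rangle=\sum_i\alpha_i\beta_i$. A homogeneous vector or map and its degree/weight are denoted by the same symbol; $e_1=(1,0,\ldots,0)\in\mathbb{Z}^n$. A $\mathbb{Z}^m$-graded Lie algebra has a weight $0$ bracket with $[a,b]=-(-1)^{\langle a,b\rangle}[b,a]$ and $[a,[b,c]]=[[a,b],c]+(-1)^{\langle a,b\rangle}[b,[a,c]]$. $M^{(A,a)}(V)$, $a\ge0$, is the space of $(a+1)$-linear maps $V^{\times(a+1)}\to V$ of weight $A\in\mathbb{Z}^n$, and $M_r(V)=\bigoplus_{A\in\mathbb{Z}^n,\,a\ge0}M^{(A,a)}(V)$, where $M^{(A,a)}(V)$ has degree $(A,a)\in\mathbb{Z}^n\times\mathbb{Z}$. Tensor coalgebra. For a graded space $W$, $T(W)=\bigoplus_{p\ge1}W^{\otimes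 p}$, $\mathbb{Z}^n$-graded by total degree, with coproduct $\Delta(w_1\otimes\ldots\otimes w_p)=\sum_{I\cup J=N^{(p-1)},\,I\ne\emptyset}\varepsilon_W(I;J)W_I\bigotimes W_J\otimes w_p$. Here $N^{(p)}=(1,\ldots,p)$, $I,J$ are disjoint naturally ordered subsets (unshuffles) with the given union, $W_I=w_{i_1}\otimes\ldots\otimes w_{i_{|I|}}$, and $\varepsilon_W(I;J)$ is the Koszul sign of the rearrangement of $(W_I,W_J)$ into increasing index order. Tensor products of maps: $(f\otimes g)(v_1\otimes v_2)=(-1)^{\langle g,v_1\rangle}f(v_1)\otimes g(v_2)$. A weight $Q$ coderivation is a weight $Q$ linear map with $\Delta Q=(Q\otimes\mathrm{id}+\mathrm{id}\otimes Q)\Delta$. The graded commutator is $[Q,Q']=QQ'-(-1)^{\langle Q,Q'\rangle}Q'Q$. A weight $Q$ coderivation is uniquely determined by its corestrictions $Q_p:W^{\otimes p}\hookrightarrow T(W)\xrightarrow{Q}T(W)\to W$, which can be arbitrary weight $Q$ maps, via $$Q(w_1\otimes\ldots\otimes w_p)=\sum_{I\cup J\cup K=N^{(p)},\;I,J<K}\varepsilon_W(I;J)(-1)^{\langle Q,W_I\rangle}W_I\otimes Q_{|J|+1}(W_J\otimes w_{k_1})\otimes W_{K\setminus k_1},$$ with $I,J$ possibly empty, $K=(k_1<k_2<\ldots)$ nonempty, and $I<K$ meaning that the last element of $I$ is smaller than $k_1$. $\mathrm{CoDer}^Q_p(T(W))$ denotes the weight $Q$ coderivations all of whose corestrictions vanish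 except possibly $Q_p$. Desuspension. $\downarrow V$ is $V$ with grading $(\downarrow V)^\alpha=V^{\alpha+e_1}$; $\downarrow:V\to\downarrow V$ has weight $-e_1$ and inverse $\uparrow$ of weight $e_1$; $\uparrow^{\otimes p}=\uparrow\otimes\ldots\otimes\uparrow$ with the sign convention $(f\otimes g)(v_1\otimes v_2)=(-1)^{\langle g,v_1\rangle}f(v_1)\otimes g(v_2)$ for tensor products of maps. The isomorphism $\phi_{(A,a)}:M^{(A,a)}(V)\to\mathrm{CoDer}^{A+ae_1}_{a+1}(T(\downarrow V))$ sends $A$ to the coderivation $Q^A$ whose only (possibly) nonzero corestriction is $Q^A_{a+1}=(-1)^{\frac{a(a+1)}{2}}\downarrow\circ A\circ\uparrow^{\otimes(a+1)}$. *)

(* Defs.v *)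
From HB Require Import structures.
From mathcomp Require Import all_boot all_order all_algebra.
From mathcomp Require Import generic_quotient ring_quotient.
From mathcomp Require Import boolp classical_sets functions.
From mathcomp.multinomials Require Import freeg.

Set Implicit Arguments.
Unset Strict Implicit.
Unset Printing Implicit Defensive.

Import GRing.Theory.
Local Open Scope ring_scope.
Local Open Scope quotient_scope.
Local Open Scope classical_set_scope.

Section Quotient.
Variables (K : fieldType) (M : lmodType K) (S : set M).

Definition lspan (x : M) : Prop :=
  exists s : seq (K * M),
    (forall p, p \in s -> S p.2) /\ x = \sum_(p <- s) p.1 *: p.2.

Definition lspanb : {pred M} := fun x => `[< lspan x >].

Lemma lspan0 : lspan 0.
Proof. by exists [::]; split=> //; rewrite big_nil. Qed.

Lemma lspanD x y : lspan x -> lspan y -> lspan (x + y).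
Proof.
move=> [s [Ss ->]] [t [St ->]]; exists (s ++ t); split; last by rewrite big_cat.
by move=> p; rewrite mem_cat => /orP[/Ss|/St].
Qed.

Lemma lspanZ c x : lspan x -> lspan (c *: x).
Proof.
move=> [s [Ss ->]]; exists [seq (c * p.1, p.2) | p <- s]; split.
  by move=> _ /mapP[p /Ss ? ->].
by rewrite big_map scaler_sumr; apply: eq_bigr => p _ /=; rewrite scalerA.
Qed.

Lemma lspanb_zmod : zmod_closed lspanb.
Proof.
split=> [|x y]; first by apply/asboolP; exact: lspan0.
move=> /asboolP xS /asboolP yS; apply/asboolP/lspanD => //.
by rewrite -scaleN1r; exact: lspanZ.
Qed.

HB.instance Definition _ := GRing.isZmodClosed.Build M lspanb lspanb_zmod.

Definition lquot := Quotient.quot lspanb.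
HB.instance Definition _ := GRing.Zmodule.on lquot.
HB.instance Definition _ := Quotient.on lquot.

Definition lquot_scale (c : K) : lquot -> lquot :=
  lift_op1 lquot (fun x : M => c *: x).

Lemma pi_lquot_scale c x :
  lquot_scale c (\pi_lquot x) = \pi_lquot (c *: x) :> lquot.
Proof.
rewrite /lquot_scale; unlock; apply/eqP.
rewrite -Quotient.idealrBE -scalerBr; apply/asboolP/lspanZ/asboolP.
by rewrite -[X in is_true X]/(_ \in lspanb) Quotient.idealrBE reprK.
Qed.

Lemma pi_lquotD x y : \pi_lquot (x + y) = \pi_lquot x + \pi_lquot y :> lquot.
Proof. exact: raddfD. Qed.

Lemma lquot_scaleA a b v :
  lquot_scale a (lquot_scale b v) = lquot_scale (a * b) v.
Proof. by rewrite -[v]reprK !pi_lquot_scale scalerA. Qed.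
Lemma lquot_scale1 : left_id 1 lquot_scale.
Proof. by move=> v; rewrite -[v]reprK pi_lquot_scale scale1r. Qed.
Lemma lquot_scaleDr : right_distributive lquot_scale +%R.
Proof.
move=> a u v; rewrite -[u]reprK -[v]reprK -pi_lquotD !pi_lquot_scale.
by rewrite -pi_lquotD scalerDr.
Qed.
Lemma lquot_scaleDl v : {morph lquot_scale^~ v : a b / a + b}.
Proof.
by move=> a b; rewrite -[v]reprK !pi_lquot_scale -pi_lquotD scalerDl.
Qed.

HB.instance Definition _ := GRing.Zmodule_isLmodule.Build K lquot
  lquot_scaleA lquot_scale1 lquot_scaleDr lquot_scaleDl.

End Quotient.

Section Presented.
Variables (K : fieldType) (X : choiceType) (rels : set {freeg X / K}).

Definition presented := @lquot K {freeg X / K} rels.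
HB.instance Definition _ := GRing.Lmodule.on presented.

Definition pgen (x : X) : presented :=
  \pi_(lquot rels) (<< 1 *g x >> : {freeg X / K}).

(* The linear extension of [h] to the presented module; it is computed on a
   representative, so it is meaningful when the linear extension of [h] to the
   free module kills [rels] (see [plift_linear] and [plift_gen]). *)
Definition plift (N : lmodType K) (h : X -> N) (t : presented) : N :=
  fglift h (repr (t : lquot rels)).

Section Lift.
Variables (N : lmodType K) (h : X -> N).

Lemma fgliftB : {morph fglift h : x y / x - y}.
Proof. exact: lift_is_additive. Qed.

Lemma fgliftD : {morph fglift h : x y / x + y}.
Proof.
have f0 : fglift h 0 = 0 by rewrite -(subrr 0) fgliftB subrr.
have fN x : fglift h (- x) = - fglift h x by rewrite -sub0r fgliftB f0 sub0r.
by move=> x y; rewrite -[y in LHS]opprK fgliftB fN opprK.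
Qed.

Lemma fglift_sum (I : Type) (s : seq I) (F : I -> {freeg X / K}) :
  fglift h (\sum_(i <- s) F i) = \sum_(i <- s) fglift h (F i).
Proof.
apply: (big_morph _ fgliftD).
by rewrite -(subrr 0) fgliftB subrr.
Qed.

Lemma fgliftZ c : {morph fglift h : x / c *: x}.
Proof.
move=> x; rewrite -[in RHS](freeg_sumE x) [c *: x]/(fgscale c x) /fgscale.
rewrite !fglift_sum scaler_sumr; apply: eq_bigr => z _.
by rewrite !liftU scalerA.
Qed.

Hypothesis h_rels : forall r, rels r -> fglift h r = 0.

Lemma plift_pi (x : {freeg X / K}) : plift h (\pi_(lquot rels) x) = fglift h x.
Proof.
rewrite /plift; set y := repr _.
have : y - x \in lspanb rels by rewrite Quotient.idealrBE /y reprK.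
move=> /asboolP[s [Ss yxE]]; apply/eqP; rewrite -subr_eq0 -fgliftB yxE.
rewrite fglift_sum big_seq big1 // => p /Ss /h_rels hp.
by rewrite fgliftZ hp scaler0.
Qed.

Lemma plift_gen x : plift h (pgen x) = h x.
Proof. by rewrite plift_pi liftU scale1r. Qed.

Lemma plift_linear : linear (plift h).
Proof.
move=> c x y; rewrite -[x](@reprK _ (lquot rels)) -[y](@reprK _ (lquot rels)).
rewrite -[c *: _]/(lquot_scale c _) pi_lquot_scale -[_ + _]pi_lquotD.
by rewrite !plift_pi fgliftD fgliftZ.
Qed.

End Lift.
End Presented.

Section Tensor.
Variables (K : fieldType) (U V : lmodType K).

Definition tensor_rels : set {freeg (U * V)%type / K} := [set r |
  (exists c x x' y, r = << 1 *g (c *: x + x', y) >>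
                        - c *: << 1 *g (x, y) >> - << 1 *g (x', y) >>) \/
  (exists c x y y', r = << 1 *g (x, c *: y + y') >>
                        - c *: << 1 *g (x, y) >> - << 1 *g (x, y') >>)].

Definition tensor := presented tensor_rels.
HB.instance Definition _ := GRing.Lmodule.on tensor.

Definition tpure (x : U) (y : V) : tensor := pgen tensor_rels (x, y).

End Tensor.

Definition tensor_map (K : fieldType) (U V U' V' : lmodType K)
    (f : U -> U') (g : V -> V') : tensor U V -> tensor U' V' :=
  plift (fun p => tpure (f p.1) (g p.2)).

Definition dot m (a b : 'rV[int]_m) : int := \sum_i a ord0 i * b ord0 i.

Definition gvect (K : fieldType) m := 'rV[int]_m -> lmodType K.

Definition gcast (K : fieldType) m (L : gvect K m) a b (e : a = b) (x : L a) :
  L b := ecast i (L i) e x.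

Definition ksign (K : fieldType) (z : int) : K := (-1) ^ z.
Arguments ksign : clear implicits.

(* The two sides of the axioms have propositionally equal degrees; [gcast]
   identifies the corresponding components. *)
Definition graded_lie (K : fieldType) m (L : gvect K m)
    (br : forall a b, L a -> L b -> L (a + b)) : Prop :=
  [/\ (forall a b y, linear (fun x : L a => br a b x y)),
      (forall a b x, linear (br a b x)),
      (forall a b (x : L a) (y : L b),
         br a b x y = - (ksign K (dot a b) *: gcast (addrC b a) (br b a y x))) &
      (forall a b c (x : L a) (y : L b) (z : L c),
         br a (b + c) x (br b c y z) =
           gcast (esym (addrA a b c)) (br (a + b) c (br a b x y) z) +
           ksign K (dot a b) *:
             gcast (addrCA b a c) (br b (a + c) y (br a c x z)))].

Section TensorCoalgebra.
Variables (K : fieldType) (n : nat) (W : gvect K n).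

Definition letter := {al : 'rV[int]_n & W al}.

Definition mkletter al (x : W al) : letter := Tagged W x.

Definition letter0 : letter := mkletter (0 : W 0).

Definition lscale (c : K) (l : letter) : letter := mkletter (c *: tagged l).

Definition wdeg (w : seq letter) : 'rV[int]_n := \sum_(l <- w) tag l.

(* Since [W] is the direct sum of its homogeneous components, [T(W)] is
   generated by the words of length at least 1 in homogeneous letters, subject
   to linearity in each letter within a fixed degree. *)
Definition word_rels : set {freeg (seq letter) / K} := [set r |
  r = << 1 *g [::] >> \/
  exists (u v : seq letter) al (c : K) (x y : W al),
    r = << 1 *g u ++ mkletter (c *: x + y) :: v >>
        - c *: << 1 *g u ++ mkletter x :: v >>
        - << 1 *g u ++ mkletter y :: v >>].

Definition tcoalg := presented word_rels.
HB.instance Definition _ := GRing.Lmodule.on tcoalg.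

(* [word [:: w_1; ...; w_p]] is the tensor w_1 ⊗ ... ⊗ w_p. *)
Definition word (w : seq letter) : tcoalg := pgen word_rels w.

Definition tlift (N : lmodType K) (h : seq letter -> N) : tcoalg -> N :=
  plift h.

Definition thomog (al : 'rV[int]_n) : set tcoalg :=
  lspan [set word w | w in [set w | wdeg w = al]].

(* The [true] entries of the mask [m] are the positions in I, the [false] ones
   those in J; the exponent collects the pairs j < i, j in J, i in I. *)
Definition koszul (w : seq letter) (m : bitseq) : K :=
  ksign K (\sum_(i < size w) \sum_(j < i | nth false m i && ~~ nth false m j)
             dot (tag (nth letter0 w i)) (tag (nth letter0 w j))).

Definition maskC (m : bitseq) (w : seq letter) := mask (map negb m) w.

Definition Delta_word (w : seq letter) : tensor tcoalg tcoalg :=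
  if w is l :: s then
    let w' := belast l s in
    \sum_(m : (size s).-tuple bool | true \in m)
      koszul w' m *: tpure (word (mask m w')) (word (rcons (maskC m w') (last l s)))
  else 0.

Definition Delta : tcoalg -> tensor tcoalg tcoalg := tlift Delta_word.

Definition degree_sign (be : 'rV[int]_n) : tcoalg -> tcoalg :=
  tlift (fun w => ksign K (dot be (wdeg w)) *: word w).

(* f ⊗ g for [g] of weight [be]: v1 ⊗ v2 |-> (-1)^<be, v1> f(v1) ⊗ g(v2). *)
Definition ktensor (f : tcoalg -> tcoalg) (be : 'rV[int]_n)
    (g : tcoalg -> tcoalg) : tensor tcoalg tcoalg -> tensor tcoalg tcoalg :=
  tensor_map (f \o degree_sign be) g.

Definition has_weight (Q : 'rV[int]_n) (F : tcoalg -> tcoalg) : Prop :=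
  forall al t, thomog al t -> thomog (al + Q) (F t).

Definition coderivation (Q : 'rV[int]_n) (F : tcoalg -> tcoalg) : Prop :=
  [/\ linear F, has_weight Q F &
      forall t, Delta (F t) = ktensor F 0 id (Delta t) + ktensor id Q F (Delta t)].

(* The projection of [T(W)] onto its summand W of tensors of length 1. *)
Definition corestr : tcoalg -> tcoalg :=
  tlift (fun w => if size w == 1%N then word w else 0).

Definition CoDer (Q : 'rV[int]_n) (p : nat) : set (tcoalg -> tcoalg) :=
  [set F | coderivation Q F /\
           forall w, size w != p -> corestr (F (word w)) = 0].

(* The coderivation of weight [Q] with corestrictions [q]; K \ k_1 is the part
   of the word after the position [k] of k_1, and I, J split the part before. *)
Definition coder_word (Q : 'rV[int]_n) (q : seq letter -> letter)
    (w : seq letter) : tcoalg :=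
  \sum_(k < size w) \sum_(m : k.-tuple bool)
    let w' := take k w in
    (koszul w' m * ksign K (dot Q (wdeg (mask m w')))) *:
      word (mask m w' ++ q (rcons (maskC m w') (nth letter0 w k))
              :: drop k.+1 w).

Definition coder_of Q q : tcoalg -> tcoalg := tlift (coder_word Q q).

Definition commutator (P : 'rV[int]_n) (F : tcoalg -> tcoalg)
    (Q : 'rV[int]_n) (G : tcoalg -> tcoalg) : tcoalg -> tcoalg :=
  fun t => F (G t) - ksign K (dot P Q) *: G (F t).

End TensorCoalgebra.

Section MultilinearMaps.
Variables (K : fieldType) (n : nat) (V : gvect K n).

(* An (a+1)-linear map of weight [A] on the direct sum of the V^al is given by
   its components on the products of homogeneous components. *)
Definition mfun (A : 'rV[int]_n) (a : nat) :=
  forall al : 'I_a.+1 -> 'rV[int]_n,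
    (forall i, V (al i)) -> V (A + \sum_i al i).

Definition multilinear A a (f : mfun A a) : Prop :=
  forall al (v : forall i, V (al i)) (i : 'I_a.+1),
    linear (fun x : V (al i) => f al (dfwith v x)).

Record mmap (A : 'rV[int]_n) (a : nat) := Mmap {
  mval :> forall al : 'I_a.+1 -> 'rV[int]_n,
    (forall i, V (al i)) -> V (A + \sum_i al i);
  mvalP : @multilinear A a mval }.

Section Lmodule.
Variables (A : 'rV[int]_n) (a : nat).
Local Notation M := (mmap A a).

Lemma mmapP (f g : M) : (forall al v, f al v = g al v) -> f = g.
Proof.
case: f g => [f fP] [g gP] /= fg.
have {}fg : f = g.
  by apply: functional_extensionality_dep => al;
     apply: functional_extensionality_dep.
by subst g; congr Mmap; exact: Prop_irrelevance.
Qed.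

HB.instance Definition _ := gen_eqMixin M.
HB.instance Definition _ := gen_choiceMixin M.

Fact mmap_zeroP : @multilinear A a (fun al v => 0 : V (A + \sum_i al i)).
Proof. by move=> al v i c x y; rewrite scaler0 addr0. Qed.
Fact mmap_oppP (f : M) : @multilinear A a (fun al v => - f al v).
Proof. by move=> al v i c x y; rewrite mvalP opprD scalerN. Qed.
Fact mmap_addP (f g : M) : @multilinear A a (fun al v => f al v + g al v).
Proof. by move=> al v i c x y; rewrite !mvalP scalerDr addrACA. Qed.
Fact mmap_scaleP c (f : M) : @multilinear A a (fun al v => c *: f al v).
Proof.
by move=> al v i d x y; rewrite mvalP scalerDr !scalerA mulrC.
Qed.

Definition mmap_zero := Mmap mmap_zeroP.
Definition mmap_opp f := Mmap (mmap_oppP f).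
Definition mmap_add f g := Mmap (mmap_addP f g).
Definition mmap_scale c f := Mmap (mmap_scaleP c f).

Fact mmap_addA : associative mmap_add.
Proof. by move=> f g h; apply: mmapP => al v; exact: addrA. Qed.
Fact mmap_addC : commutative mmap_add.
Proof. by move=> f g; apply: mmapP => al v; exact: addrC. Qed.
Fact mmap_add0 : left_id mmap_zero mmap_add.
Proof. by move=> f; apply: mmapP => al v; exact: add0r. Qed.
Fact mmap_addN : left_inverse mmap_zero mmap_opp mmap_add.
Proof. by move=> f; apply: mmapP => al v; exact: addNr. Qed.

HB.instance Definition _ :=
  GRing.isZmodule.Build M mmap_addA mmap_addC mmap_add0 mmap_addN.

Fact mmap_scaleA c d f : mmap_scale c (mmap_scale d f) = mmap_scale (c * d) f.
Proof. by apply: mmapP => al v; exact: scalerA. Qed.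
Fact mmap_scale1 : left_id 1 mmap_scale.
Proof. by move=> f; apply: mmapP => al v; exact: scale1r. Qed.
Fact mmap_scaleDr : right_distributive mmap_scale +%R.
Proof. by move=> c f g; apply: mmapP => al v; exact: scalerDr. Qed.
Fact mmap_scaleDl f : {morph mmap_scale^~ f : c d / c + d}.
Proof. by move=> c d; apply: mmapP => al v; exact: scalerDl. Qed.

HB.instance Definition _ := GRing.Zmodule_isLmodule.Build K M
  mmap_scaleA mmap_scale1 mmap_scaleDr mmap_scaleDl.

End Lmodule.

Definition e1 : 'rV[int]_n := \row_j (j == 0%N :> nat)%:R.

Definition desusp : gvect K n := fun al => V (al + e1).

Definition up (l : letter desusp) : letter V :=
  mkletter (tagged l : V (tag l + e1)).

Definition down (l : letter V) : letter desusp :=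
  @mkletter _ _ desusp (tag l - e1) (gcast (esym (subrK e1 (tag l))) (tagged l)).

(* Exponent of the sign of ↑ ⊗ ... ⊗ ↑ on a word: the copies of ↑ acting on
   the letters to the right of [l], of total weight [size s *: e1], pass [l]. *)
Fixpoint up_sign (w : seq (letter desusp)) : int :=
  if w is l :: s then dot (e1 *+ size s) (tag l) + up_sign s else 0.

Section Phi.
Variables (A : 'rV[int]_n) (a : nat).

(* Meaningful on words of length [a.+1]. *)
Definition mapply (f : mmap A a) (w : seq (letter V)) : letter V :=
  mkletter (f (fun i => tag (nth (letter0 V) w i))
              (fun i => tagged (nth (letter0 V) w i))).

Definition phi_cor (f : mmap A a) (w : seq (letter desusp)) :
    letter desusp :=
  if size w == a.+1 then
    lscale (ksign K (((a * a.+1)./2)%N%:Z + up_sign w))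
      (down (mapply f (map up w)))
  else letter0 desusp.

Definition phi (f : mmap A a) : tcoalg desusp -> tcoalg desusp :=
  coder_of (A + e1 *+ a) (phi_cor f).

End Phi.

(* M_r(V) has no component of negative degree [a]. *)
Definition Mz (A : 'rV[int]_n) (a : int) : lmodType K :=
  if a is Posz k then mmap A k else 'rV[K]_0.

Definition phiz (A : 'rV[int]_n) (a : int) :
    Mz A a -> tcoalg desusp -> tcoalg desusp :=
  match a with
  | Posz k => @phi A k
  | Negz _ => fun _ _ => 0
  end.

(* [phiz A a] is injective, so this is its inverse on its image. *)
Definition phiz_inv (A : 'rV[int]_n) (a : int)
    (F : tcoalg desusp -> tcoalg desusp) : Mz A a :=
  xget 0 [set f | @phiz A a f = F].

(* A degree in Z^(n+1) is split as (A, a). *)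
Definition wt (d : 'rV[int]_(n + 1)) : 'rV[int]_n := lsubmx d.
Definition ar (d : 'rV[int]_(n + 1)) : int := rsubmx d ord0 ord0.

Definition Mr : gvect K (n + 1) := fun d => Mz (wt d) (ar d).

Definition Mr_bracket (d d' : 'rV[int]_(n + 1)) (f : Mr d) (g : Mr d') :
    Mr (d + d') :=
  let A := wt d in let a := ar d in let B := wt d' in let b := ar d' in
  ksign K (1 + dot (e1 *~ a) (e1 *~ b + B)) *:
    phiz_inv (wt (d + d')) (ar (d + d'))
      (commutator (A + e1 *~ a) (phiz f) (B + e1 *~ b) (phiz g)).

End MultilinearMaps.

(* Main.v *)
From mathcomp Require Import all_boot all_order all_algebra.
From mathcomp Require Import generic_quotient ring_quotient.
From mathcomp Require Import boolp classical_sets functions.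
From mathcomp.multinomials Require Import freeg.
From mathcomp Require Import ring.
Require Import Defs.
Set Implicit Arguments.
Unset Strict Implicit.
Unset Printing Implicit Defensive.
Import GRing.Theory.
Local Open Scope ring_scope.
Local Open Scope quotient_scope.
Local Open Scope classical_set_scope.

(** Why the theorem holds.

The bracket is a commutator of coderivations, transported along [phi] and
rescaled by a sign. So there are three things to know: that [phi] identifies
multilinear maps with coderivations, that commutators of coderivations are
coderivations of the right shape, and that the rescaling turns the
grading of the commutator into the grading by pairs (A, a).

The coproduct of a word peels off its last letter and unshuffles the rest, so
all computations happen with sums over unshuffles. They are evaluated with a
function: [unsh h w] is the sum of the signed values h I J over the unshuffles
(I, J) of w, and [coder_with Q q h w] is the sum of the signed values of h on
the words in the formula for the coderivation with corestrictions q. Taking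
for h a tensor or a further sum of this kind gives composites of
coproducts and coderivations without any tensor algebra. Unshuffles are
coassociative ([unshA]) and cocommutative up to sign ([unshC]), and from this
an induction on the last letter gives [coder_with_unsh]: applying the
coderivation formula and then unshuffling is the same as unshuffling and then
applying the formula to the left or to the right part. The version for the
coproduct is [coder_with_half_unsh]; it says that the formula defines a
coderivation ([coder_of_coderivation]).

Conversely a coderivation is determined by its corestrictions
([coderivation_unique]): a tensor t is the sum of its component of length one
and of the image of the coproduct of t under the map that concatenates u and v
when u is nonempty and v is a single letter ([corestr_append_Delta]), so induction on the length
of words applies. Since the corestriction of [phi f] is f up to
desuspension and a sign, [phi] is injective, and for a coderivation F with a
single corestriction one reads off a multilinear f with the same corestriction
as F ([phi_preim], [phi_preimK]); hence [phi_bij].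

The commutator of coderivations F and G is a coderivation because in the
expansion of the coproduct of FG - (-1)^<P, Q> GF the mixed terms, in which F
and G act on different tensor factors, cancel ([ktensor_swap],
[commutator_coderivation]). Counting letters
shows that only one corestriction of the commutator of [phi f] and [phi g]
survives ([corestr_phi_phi]).

Finally let D d = A + a e1 be the weight of the coderivation of an element of
degree d = (A, a), and let tau(d, d') be the sign of <a e1, D d'>. The bracket is
sent by phi to -tau(d, d') times the commutator ([phiz_bracket]). As tau is
bimultiplicative, the three double brackets in the Jacobi identity carry a
common product of signs, and [twist_sign], the identity
(-1)^<d, d'> = (-1)^<D d, D d'> tau(d, d') tau(d', d), converts antisymmetry and
the Jacobi identity for commutators into those for the bracket. *)

(** * Signs and linear maps *)

Section Signs.
Variables (K : fieldType) (m : nat).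
Implicit Types a b c : 'rV[int]_m.

Lemma dotDl a b c : dot (a + b) c = dot a c + dot b c.
Proof.
by rewrite /dot -big_split /=; apply: eq_bigr => i _; rewrite mxE mulrDl.
Qed.

Lemma dotC a b : dot a b = dot b a.
Proof. by apply: eq_bigr => i _; rewrite mulrC. Qed.

Lemma dotDr a b c : dot a (b + c) = dot a b + dot a c.
Proof. by rewrite dotC dotDl !(dotC a). Qed.

Lemma dot0r a : dot a 0 = 0.
Proof. by apply: big1 => i _; rewrite mxE mulr0. Qed.

Lemma dotMzl a b z : dot (a *~ z) b = z * dot a b.
Proof.
rewrite /dot mulr_sumr; apply: eq_bigr => i _.
rewrite -scaler_int mxE; rewrite intz mulrA //.
Qed.

Lemma ksignD (x y : int) : ksign K (x + y) = ksign K x * ksign K y.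
Proof. by rewrite /ksign expfzDr // oppr_eq0 oner_eq0. Qed.

Lemma ksign0 : ksign K 0 = 1.
Proof. by []. Qed.

Lemma ksign1 : ksign K 1 = -1.
Proof. by []. Qed.

Lemma ksign_sqr (x : int) : ksign K x * ksign K x = 1.
Proof.
by rewrite /ksign -expfzMl mulrNN mulr1 exp1rz.
Qed.

Lemma ksignK (N : lmodType K) (x : int) (t : N) :
  ksign K x *: (ksign K x *: t) = t.
Proof. by rewrite scalerA ksign_sqr scale1r. Qed.

End Signs.

Section LinearFunctions.
Variables (K : fieldType) (U V : lmodType K) (F : U -> V).
Hypothesis linF : linear F.

Lemma linD x y : F (x + y) = F x + F y.
Proof. by rewrite -[x]scale1r linF !scale1r. Qed.

Lemma lin0 : F 0 = 0.
Proof. by apply: (addrI (F 0)); rewrite -linD !addr0. Qed.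

Lemma linZ c x : F (c *: x) = c *: F x.
Proof. by rewrite -[c *: x]addr0 linF lin0 addr0. Qed.

Lemma linN x : F (- x) = - F x.
Proof. by rewrite -scaleN1r linZ scaleN1r. Qed.

Lemma linB x y : F (x - y) = F x - F y.
Proof. by rewrite linD linN. Qed.

Lemma lin_sum (I : Type) (r : seq I) (P : pred I) (G : I -> U) :
  F (\sum_(i <- r | P i) G i) = \sum_(i <- r | P i) F (G i).
Proof. exact: (big_morph F linD lin0). Qed.

End LinearFunctions.

Section LinearMaps.
Variable K : fieldType.

Lemma id_linear (M : lmodType K) : linear (@id M).
Proof. by []. Qed.

Lemma comp_linear (M1 M2 M3 : lmodType K) (f : M2 -> M3) (g : M1 -> M2) :
  linear f -> linear g -> linear (f \o g).
Proof. by move=> linf ling c x y /=; rewrite ling linf. Qed.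

Lemma comb_linear (M1 M2 : lmodType K) (f g : M1 -> M2) d :
  linear f -> linear g -> linear (fun x : M1 => f x + d *: g x).
Proof.
move=> linf ling c x y; rewrite linf ling !scalerDr !scalerA addrACA.
by rewrite [d * c]mulrC.
Qed.

Lemma add_linear (M1 M2 : lmodType K) (f g : M1 -> M2) :
  linear f -> linear g -> linear (fun x : M1 => f x + g x).
Proof. by move=> linf ling c x y; rewrite linf ling scalerDr addrACA. Qed.

End LinearMaps.

(** The bookkeeping of [commutator_coderivation]: c1 and c2 are the terms in
which the two maps act on different tensor factors. *)
Lemma cancel_cross_terms (M : zmodType) (a1 a2 b1 b2 c1 c2 : M) :
  a1 + c1 + (c2 + b1) + (- a2 - c2 + (- c1 - b2)) = a1 - a2 + (b1 - b2).
Proof.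
rewrite [c2 + b1]addrC [a1 + c1 + _]addrACA [- c1 - b2]addrC [- a2 - c2 + _]addrACA.
by rewrite [LHS]addrACA -[- c2 - c1]opprD [c2 + c1]addrC subrr addr0 addrACA.
Qed.

Section LinearSpan.
Variables (K : fieldType) (M N : lmodType K).

Lemma lspan_gen (S : set M) x : S x -> lspan S x.
Proof.
by move=> Sx; exists [:: (1, x)]; rewrite big_seq1 scale1r; split=> // p /[!inE] /eqP->.
Qed.

Lemma lspan_lin (S : set M) (S' : set N) (F : M -> N) : linear F ->
  (forall x, S x -> lspan S' (F x)) -> forall x, lspan S x -> lspan S' (F x).
Proof.
move=> linF FS x [s [Ss ->]]; rewrite lin_sum //.
elim: s Ss => [|p s IH] Ss; first by rewrite big_nil; apply: lspan0.
rewrite big_cons; apply: lspanD; last first.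
  by apply: IH => r rs; apply: Ss; rewrite inE rs orbT.
by rewrite linZ //; apply/lspanZ/FS/Ss/mem_head.
Qed.

Lemma lquot_pi_linear (S : set M) : linear (\pi_(lquot S) : M -> lquot S).
Proof. by move=> c x y; rewrite pi_lquotD -pi_lquot_scale. Qed.

(** Membership in a span becomes vanishing in the quotient, so that a statement
about a sum lying in a span can be proved by evaluating the sum in the
quotient. *)
Lemma lquot_pi_eq0 (S : set M) x : \pi_(lquot S) x = 0 :> lquot S <-> lspan S x.
Proof.
rewrite -(lin0 (lquot_pi_linear S)); split=> [/eqP|Sx]; last apply/eqP.
  by rewrite -Quotient.idealrBE subr0 => /asboolP.
by rewrite -Quotient.idealrBE subr0; apply/asboolP.
Qed.

End LinearSpan.

(** * Presented modules and tensor products *)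
Section Presented.
Variables (K : fieldType) (X : choiceType) (rels : set {freeg X / K}).

Lemma pi_linear : linear (\pi_(lquot rels) : {freeg X / K} -> presented rels).
Proof. exact: lquot_pi_linear. Qed.

(** The quotient is spanned by the classes of the generators, because the free
module is spanned by the generators. *)
Lemma presented_ext (N : lmodType K) (F G : presented rels -> N) :
    linear F -> linear G ->
    (forall x, F (pgen rels x) = G (pgen rels x)) ->
  forall t, F t = G t.
Proof.
move=> linF linG FG t.
suff E : exists s : seq (K * X),
    t = \sum_(p <- s) p.1 *: (pgen rels p.2 : presented rels).
  have [s ->] := E; rewrite !lin_sum //; apply: eq_bigr => p _.
  by rewrite !linZ ?FG.
rewrite -[t](@reprK _ (lquot rels)); set x := repr _.
(* The expansion of a representative over the generators in its support. *)
exists [seq (coeff z x, z) | z <- dom x].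
rewrite big_map -[LHS]/(\pi_(lquot rels) x) -[in LHS](freeg_sumE x).
rewrite [LHS](lin_sum pi_linear); apply: eq_bigr => z _ /=.
rewrite -(linZ pi_linear); congr (\pi_(lquot rels) _).
rewrite -[RHS]/(fgscale (coeff z x) << z >>) /fgscale domU1 big_seq1.
by rewrite coeffU eqxx !mulr1.
Qed.

Lemma presented_rel (r : {freeg X / K}) : rels r ->
  \pi_(lquot rels) r = 0 :> presented rels.
Proof. by move=> rr; apply/lquot_pi_eq0/lspan_gen. Qed.

End Presented.

Section TensorProduct.
Variables (K : fieldType) (U V : lmodType K).
Local Notation T := (tensor U V).

Lemma tpure_linl (y : V) : linear (fun x : U => tpure x y : T).
Proof.
move=> c x x'; apply/eqP; rewrite -subr_eq0 opprD addrA; apply/eqP.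
rewrite -(linZ (pi_linear _)) -2!(linB (pi_linear _)).
by apply: presented_rel; left; exists c, x, x', y.
Qed.

Lemma tpure_linr (x : U) : linear (fun y : V => tpure x y : T).
Proof.
move=> c y y'; apply/eqP; rewrite -subr_eq0 opprD addrA; apply/eqP.
rewrite -(linZ (pi_linear _)) -2!(linB (pi_linear _)).
by apply: presented_rel; right; exists c, x, y, y'.
Qed.

Lemma tensor_ext (N : lmodType K) (F G : T -> N) :
    linear F -> linear G -> (forall x y, F (tpure x y) = G (tpure x y)) ->
  forall t, F t = G t.
Proof. by move=> linF linG FG; apply: presented_ext => // -[x y]; apply: FG. Qed.

Section Lift.
Variables (N : lmodType K) (h : U * V -> N).
Hypothesis hl : forall y, linear (fun x => h (x, y)).
Hypothesis hr : forall x, linear (fun y => h (x, y)).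

Let h_rels (r : {freeg (U * V)%type / K}) :
  @tensor_rels K U V r -> fglift h r = 0.
Proof.
case=> [[c [x [x' [y ->]]]]|[c [x [y [y' ->]]]]];
  rewrite !fgliftB fgliftZ !liftU !scale1r.
  by rewrite (hl y) addrAC addrK subrr.
by rewrite (hr x) addrAC addrK subrr.
Qed.

Lemma tensor_lift_linear : linear (plift h : T -> N).
Proof. exact: plift_linear. Qed.

Lemma tensor_lift_pure x y : plift h (tpure x y : T) = h (x, y).
Proof. exact: plift_gen. Qed.

End Lift.
End TensorProduct.

Section TensorMap.
Variables (K : fieldType) (U V U' V' : lmodType K) (f : U -> U') (g : V -> V').
Hypotheses (linf : linear f) (ling : linear g).

Let fl y : linear (fun x => tpure (f x) (g y)).
Proof. by move=> c x x'; rewrite linf tpure_linl. Qed.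
Let gl x : linear (fun y => tpure (f x) (g y)).
Proof. by move=> c y y'; rewrite ling tpure_linr. Qed.

Lemma tensor_map_linear : linear (tensor_map f g).
Proof. exact: tensor_lift_linear. Qed.

Lemma tensor_map_pure x y : tensor_map f g (tpure x y) = tpure (f x) (g y).
Proof. exact: tensor_lift_pure. Qed.

End TensorMap.

(** * Words and multilinear functions of words *)
Section Words.
Variables (K : fieldType) (n : nat) (W : gvect K n).
Local Notation letter := (letter W).
Local Notation word := (@word K n W).
Local Notation sgn a b := (ksign K (dot a b)).
Implicit Types (u v w s : seq letter) (l x : letter) (N : lmodType K).

(** Letters carry their degree, so [c *: x + y] is not an operation on letters.
This relation replaces it, and avoids casts when degrees agree only
propositionally. *)
Definition lin_letters (c : K) (l l1 l2 : letter) : Prop :=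
  exists al (x y : W al),
    [/\ l = mkletter (c *: x + y), l1 = mkletter x & l2 = mkletter y].

Definition wmultilinear N (h : seq letter -> N) : Prop :=
  forall u v c l l1 l2, lin_letters c l l1 l2 ->
    h (u ++ l :: v) = c *: h (u ++ l1 :: v) + h (u ++ l2 :: v).

Lemma lin_letters_tag c l l1 l2 : lin_letters c l l1 l2 ->
  tag l1 = tag l /\ tag l2 = tag l.
Proof. by case=> al [y [z [-> -> ->]]]. Qed.

Lemma wdeg_nil : @wdeg K n W [::] = 0.
Proof. exact: big_nil. Qed.

Lemma wdeg_cons l w : wdeg (l :: w) = tag l + wdeg w.
Proof. exact: big_cons. Qed.

Lemma wdeg_cat u v : wdeg (u ++ v) = wdeg u + wdeg v.
Proof. exact: big_cat. Qed.

Lemma wdeg_rcons w l : wdeg (rcons w l) = wdeg w + tag l.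
Proof. by rewrite -cats1 wdeg_cat wdeg_cons wdeg_nil addr0. Qed.

Lemma wdeg_lin u v c l l1 l2 : lin_letters c l l1 l2 ->
  wdeg (u ++ l1 :: v) = wdeg (u ++ l :: v) /\
  wdeg (u ++ l2 :: v) = wdeg (u ++ l :: v).
Proof.
by case/lin_letters_tag=> t1 t2; rewrite !wdeg_cat !wdeg_cons t1 t2.
Qed.

Lemma word_nil : word [::] = 0.
Proof. by apply: presented_rel; left. Qed.

Lemma word_multilinear : wmultilinear word.
Proof.
move=> u v c _ _ _ [al [x [y [-> -> ->]]]].
apply/eqP; rewrite -subr_eq0 opprD addrA; apply/eqP.
rewrite -(linZ (pi_linear _)) -2!(linB (pi_linear _)).
by apply: presented_rel; right; exists u, v, al, c, x, y.
Qed.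

Lemma lin_letters0 al : lin_letters 1 (mkletter (0 : W al)) (mkletter (0 : W al))
  (mkletter (0 : W al)).
Proof. by exists al, 0, 0; rewrite scaler0 addr0. Qed.

(** The degree of a zero letter is irrelevant to the value of a multilinear
function of words. *)
Lemma multilinear_zero N (h : seq letter -> N) u v al :
  wmultilinear h -> h (u ++ mkletter (0 : W al) :: v) = 0.
Proof.
move=> /(_ u v _ _ _ _ (lin_letters0 al)); rewrite scale1r => E.
by apply: (addrI (h (u ++ mkletter (0 : W al) :: v))); rewrite -E addr0.
Qed.

Lemma tcoalg_ext N (F G : tcoalg W -> N) : linear F -> linear G ->
  (forall w, F (word w) = G (word w)) -> forall t, F t = G t.
Proof. exact: presented_ext. Qed.

Section Lift.
Variables (N : lmodType K) (h : seq letter -> N).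
Hypotheses (h0 : h [::] = 0) (hlin : wmultilinear h).

Let h_rels (r : {freeg (seq letter) / K}) :
  @word_rels K n W r -> fglift h r = 0.
Proof.
case=> [->|[u [v [al [c [x [y ->]]]]]]]; first by rewrite liftU scale1r.
rewrite !fgliftB fgliftZ !liftU !scale1r.
rewrite (@hlin u v c _ (mkletter x) (mkletter y)); last by exists al, x, y.
by rewrite addrAC addrK subrr.
Qed.

Lemma tlift_linear : linear (tlift h).
Proof. exact: plift_linear. Qed.

Lemma tlift_word w : tlift h (word w) = h w.
Proof. exact: plift_gen. Qed.

End Lift.

(** * Sums over unshuffles *)
(** The first letter goes either to the left part or to the right part; in the
second case it is passed by all of the left part, hence the sign. The value is
computed by a function [h] of the two parts, so that a tensor, a scalar or a
further sum can be put in its place. *)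
Fixpoint unsh N (h : seq letter -> seq letter -> N) w : N :=
  if w is l :: s then
    unsh (fun I J => h (l :: I) J + sgn (tag l) (wdeg I) *: h I (l :: J)) s
  else h [::] [::].

(** The sizes and the degrees of the two parts add up to those of the word: this
is what makes the signs computable under the sum. *)
Lemma unsh_ext N (h g : seq letter -> seq letter -> N) w :
    (forall I J, (size I + size J)%N = size w -> wdeg I + wdeg J = wdeg w ->
       h I J = g I J) ->
  unsh h w = unsh g w.
Proof.
elim: w h g => [|l s IH] h g hg /=.
  by apply: hg => //; rewrite wdeg_nil addr0.
apply: IH => I J sz dg; congr (_ + _ *: _); apply: hg => /=.
- by rewrite addSn sz.
- by rewrite !wdeg_cons -addrA dg.
- by rewrite addnS sz.
by rewrite !wdeg_cons addrCA dg.
Qed.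

Lemma unsh_lin N (h1 h2 : seq letter -> seq letter -> N) c w :
  unsh (fun I J => c *: h1 I J + h2 I J) w = c *: unsh h1 w + unsh h2 w.
Proof.
elim: w h1 h2 => [|l s IH] h1 h2 //=; rewrite -IH.
apply: unsh_ext => I J _ _; rewrite !scalerDr !scalerA mulrC -!addrA.
by congr (_ + _); rewrite addrCA.
Qed.

Lemma unshD N (h1 h2 : seq letter -> seq letter -> N) w :
  unsh (fun I J => h1 I J + h2 I J) w = unsh h1 w + unsh h2 w.
Proof.
rewrite -[unsh h1 w]scale1r -unsh_lin.
by apply: unsh_ext => I J _ _; rewrite scale1r.
Qed.

Lemma unsh0 N w : unsh (fun _ _ => 0 : N) w = 0.
Proof.
by elim: w => //= l s IH; rewrite -[RHS]IH; apply: unsh_ext => I J _ _;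
   rewrite scaler0 addr0.
Qed.

Lemma unshZ N (h : seq letter -> seq letter -> N) c w :
  unsh (fun I J => c *: h I J) w = c *: unsh h w.
Proof.
rewrite -[RHS]addr0 -(unsh0 N w) -unsh_lin.
by apply: unsh_ext => I J _ _; rewrite addr0.
Qed.

Lemma lin_unsh (N N' : lmodType K) (F : N -> N') h w : linear F ->
  F (unsh h w) = unsh (fun I J => F (h I J)) w.
Proof.
move=> linF; elim: w h => //= l s IH h; rewrite IH.
by apply: unsh_ext => I J _ _; rewrite linD // linZ.
Qed.

(** The last letter either stays last on the right, or passes the right part in
order to become last on the left. *)
Lemma unsh_rcons N (h : seq letter -> seq letter -> N) s l :
  unsh h (rcons s l) =
  unsh (fun I J => h I (rcons J l) + sgn (wdeg J) (tag l) *: h (rcons I l) J) s.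
Proof.
elim: s h => [|y s IH] h /=.
  by rewrite wdeg_nil dot0r dotC dot0r !scale1r addrC.
rewrite IH; apply: unsh_ext => I J _ _.
rewrite wdeg_rcons wdeg_cons dotDl dotDr !ksignD !scalerDr !scalerA.
by rewrite addrACA; congr (_ + (_ + _ *: _)); ring.
Qed.
End Words.

Section Unshuffles.
Variables (K : fieldType) (n : nat) (W : gvect K n).
Local Notation letter := (letter W).
Local Notation word := (@word K n W).
Local Notation sgn a b := (ksign K (dot a b)).
Implicit Types (u v w s : seq letter) (l x : letter) (N : lmodType K).

(** Cocommutativity up to the Koszul sign of the exchange of the two parts. *)
Lemma unshC N (h : seq letter -> seq letter -> N) w :
  unsh h w = unsh (fun I J => sgn (wdeg I) (wdeg J) *: h J I) w.
Proof.
elim: w h => [|l s IH] h /=; first by rewrite wdeg_nil dot0r scale1r.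
rewrite IH; apply: unsh_ext => I J _ _.
rewrite !wdeg_cons dotDl dotDr !ksignD scalerDr !scalerA addrC.
rewrite (dotC (tag l) (wdeg I)).
congr (_ *: _ + _ *: _); last by rewrite mulrA ksign_sqr mul1r.
by rewrite mulrC (dotC (tag l)).
Qed.

(** Coassociativity: both sides sum over the distributions of the letters into
three parts, and the sign of a letter placed at the front is the same whether
the parts are formed from the left or from the right. *)
Lemma unshA N (h : seq letter -> seq letter -> seq letter -> N) w :
  unsh (fun I J => unsh (fun I1 I2 => h I1 I2 J) I) w =
  unsh (fun I J => unsh (fun J1 J2 => h I J1 J2) J) w.
Proof.
elim: w h => //= l s IH h.
(* The three possible places of the first letter. *)
pose H I1 I2 J := h (l :: I1) I2 J + sgn (tag l) (wdeg I1) *: h I1 (l :: I2) J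
  + (sgn (tag l) (wdeg I1) * sgn (tag l) (wdeg I2)) *: h I1 I2 (l :: J).
transitivity (unsh (fun I J => unsh (fun I1 I2 => H I1 I2 J) I) s).
  apply: unsh_ext => I J _ _; rewrite -unshZ -unshD.
  by apply: unsh_ext => I1 I2 _ <-; rewrite dotDr ksignD.
rewrite IH; apply: unsh_ext => I J _ _; rewrite -unshZ -unshD.
by apply: unsh_ext => J1 J2 _ _; rewrite /H scalerDr scalerA addrA.
Qed.

(** Counit laws: only the unshuffle with one empty part survives, with sign 1. *)
Lemma unsh_counitl N (g : seq letter -> N) w :
  unsh (fun I J => if I is [::] then g J else 0) w = g w.
Proof.
elim: w g => //= l s IH g; rewrite -[RHS](IH (fun J => g (l :: J))).
apply: unsh_ext => -[|y I] J _ _; last by rewrite scaler0 addr0.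
by rewrite wdeg_nil dot0r scale1r add0r.
Qed.

Lemma unsh_counitr N (g : seq letter -> N) w :
  unsh (fun I J => if J is [::] then g I else 0) w = g w.
Proof.
rewrite unshC -[RHS]unsh_counitl; apply: unsh_ext => -[|y I] J _ _.
  by rewrite wdeg_nil dotC dot0r scale1r.
by rewrite scaler0.
Qed.

Lemma unsh_multilinear N (h : seq letter -> seq letter -> N) :
    (forall J, wmultilinear (fun I => h I J)) ->
    (forall I, wmultilinear (h I)) ->
  wmultilinear (unsh h).
Proof.
move=> hl hr u; elim: u h hl hr => [|x u IH] h hl hr v c l l1 l2 ll /=.
  rewrite -unsh_lin; apply: unsh_ext => I J _ _.
  have [-> ->] := lin_letters_tag ll.
  rewrite (hl J [::] I _ _ _ _ ll) (hr I [::] J _ _ _ _ ll) /=.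
  by rewrite !scalerDr !scalerA addrACA [c * _]mulrC.
apply: IH ll => [J|I] u1 v1 d y y1 y2 yy /=.
  have [-> ->] := wdeg_lin u1 v1 yy.
  rewrite (hl J (x :: u1) v1 _ _ _ _ yy) (hl _ u1 v1 _ _ _ _ yy) /=.
  by rewrite !scalerDr !scalerA addrACA [d * _]mulrC.
rewrite (hr _ u1 v1 _ _ _ _ yy) (hr I (x :: u1) v1 _ _ _ _ yy) /=.
by rewrite !scalerDr !scalerA addrACA [d * _]mulrC.
Qed.

(** Only the pairs formed with the first letter are new: they count when this
letter goes to the right, and then contribute the degrees of all letters sent to
the left. *)
Lemma koszul_cons l s b (m : bitseq) : size m = size s ->
  koszul (l :: s) (b :: m) =
  (if b then 1 else sgn (tag l) (wdeg (mask m s))) * koszul s m.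
Proof.
move=> sm; rewrite /koszul /= big_ord_recl big_ord0 add0r.
have E i : \sum_(j < i.+1 | nth false m i && ~~ nth false (b :: m) j)
      dot (tag (nth (letter0 W) s i)) (tag (nth (letter0 W) (l :: s) j)) =
    (if nth false m i && ~~ b then dot (tag (nth (letter0 W) s i)) (tag l)
     else 0) +
    \sum_(j < i | nth false m i && ~~ nth false m j)
      dot (tag (nth (letter0 W) s i)) (tag (nth (letter0 W) s j)).
  by rewrite big_mkcond big_ord_recl -big_mkcond.
rewrite [X in ksign K X](eq_bigr _ (fun (i : 'I_(size s)) _ => E i)).
rewrite big_split /= ksignD; congr (_ * _).
clear E; case: b; first by rewrite big1 ?ksign0 // => i _; rewrite andbF.
congr (ksign K _).
under eq_bigr do rewrite andbT /=.
elim: s m sm => [|y s IH] [|c m] //=.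
  by rewrite big_ord0 wdeg_nil dot0r.
case=> sm; rewrite big_ord_recl /= IH //.
by case: c; rewrite ?wdeg_cons ?dotDr ?add0r // (dotC (tag y)).
Qed.

Lemma sum_tuple_cons (N : nmodType) k (F : bitseq -> N) :
  \sum_(m : k.+1.-tuple bool) F m =
  \sum_(m : k.-tuple bool) (F (true :: m) + F (false :: m)).
Proof.
rewrite big_split /=.
rewrite (reindex (fun p : bool * k.-tuple bool => [tuple of p.1 :: p.2])) /=.
  by rewrite -(pair_bigA _ (fun b (m : k.-tuple bool) => F (b :: m))) big_bool.
exists (fun m => (thead m, [tuple of behead m])) => [[b m]|m] _ /=.
  by congr (_, _); apply/val_inj.
by rewrite -tuple_eta.
Qed.

(** Bridge to the sums over masks by which the coproduct and the coderivations
are defined. *)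
Lemma unsh_mask N (h : seq letter -> seq letter -> N) w :
  \sum_(m : (size w).-tuple bool) koszul w m *: h (mask m w) (maskC m w) =
  unsh h w.
Proof.
elim: w h => [|l s IH] h /=.
  rewrite (big_pred1 [tuple]) => [|m]; last exact/esym/eqP/tuple0.
  by rewrite /koszul /= big_ord0 scale1r.
rewrite (sum_tuple_cons _ (fun m : bitseq => koszul (l :: s) m *:
  h (mask m (l :: s)) (maskC m (l :: s)))) -IH; apply: eq_bigr => m _.
rewrite !koszul_cons ?size_tuple // mul1r scalerDr scalerA.
by rewrite [koszul s m * _]mulrC.
Qed.

End Unshuffles.

(** * The formula for coderivations *)
Section Coderivations.
Variables (K : fieldType) (n : nat) (W : gvect K n).
Local Notation letter := (letter W).
Local Notation word := (@word K n W).
Local Notation sgn a b := (ksign K (dot a b)).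
Implicit Types (u v w s : seq letter) (l x : letter) (N : lmodType K).

Variables (Q : 'rV[int]_n) (q : seq letter -> letter).

(** The summands of [coder_word], with [h] in place of [word]. *)
Definition coder_with N (h : seq letter -> N) w : N :=
  \sum_(k < size w)
    unsh (fun I J => sgn Q (wdeg I) *:
      h (I ++ q (rcons J (nth (letter0 W) w k)) :: drop k.+1 w)) (take k w).

Lemma coder_with_nil N (h : seq letter -> N) : coder_with h [::] = 0.
Proof. by rewrite /coder_with big_ord0. Qed.

(** The distinguished letter k_1 lies before the last letter, which then stays at
the end, or it is the last letter. This recursion carries all inductions
below. *)
Lemma coder_with_rcons N (h : seq letter -> N) s l :
  coder_with h (rcons s l) = coder_with (fun w => h (rcons w l)) s +
    unsh (fun I J => sgn Q (wdeg I) *: h (rcons I (q (rcons J l)))) s.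
Proof.
rewrite /coder_with size_rcons big_ord_recr /= nth_rcons ltnn eqxx.
rewrite -cats1 take_size_cat // drop_oversize ?size_cat ?addn1 //.
congr (_ + _).
  apply: eq_bigr => k _; rewrite takel_cat 1?ltnW // nth_cat ltn_ord.
  apply: unsh_ext => I J _ _; rewrite drop_cat.
  have := ltn_ord k; rewrite leq_eqVlt => /predU1P[->|->].
    by rewrite ltnn subnn drop0 drop_size rcons_cat.
  by rewrite rcons_cat rcons_cons cats1.
by apply: unsh_ext => I J _ _; rewrite cats1.
Qed.

(** The words that occur are of the form [u ++ q s :: v] where [u], [s] and [v]
share out the letters of [w], and [s] contains the distinguished letter. *)
Lemma coder_with_ext N (h g : seq letter -> N) w :
    (forall u s v, s != [::] -> (size u + size s + size v)%N = size w ->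
       wdeg u + wdeg s + wdeg v = wdeg w ->
       h (u ++ q s :: v) = g (u ++ q s :: v)) ->
  coder_with h w = coder_with g w.
Proof.
elim/last_ind: w h g => [|s l IH] h g hg; first by rewrite !coder_with_nil.
rewrite !coder_with_rcons; congr (_ + _).
  apply: IH => u x v x0 sz dg; rewrite !rcons_cat !rcons_cons; apply: hg => //.
    by rewrite !size_rcons -sz addnS.
  by rewrite !wdeg_rcons -dg !addrA.
apply: unsh_ext => I J sz dg; congr (_ *: _); rewrite -!cats1; apply: hg.
- by rewrite cats1; case: (J).
- by rewrite cats1 addn0 !size_rcons addnS sz.
by rewrite cats1 wdeg_nil addr0 !wdeg_rcons addrA dg.
Qed.

Lemma coder_with_lin N (h1 h2 : seq letter -> N) c w :
  coder_with (fun w => c *: h1 w + h2 w) w =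
  c *: coder_with h1 w + coder_with h2 w.
Proof.
rewrite /coder_with scaler_sumr -big_split /=; apply: eq_bigr => k _.
rewrite -unsh_lin; apply: unsh_ext => I J _ _.
by rewrite scalerDr !scalerA mulrC.
Qed.

Lemma coder_with0 N w : coder_with (fun _ => 0 : N) w = 0.
Proof.
rewrite /coder_with big1 // => k _; rewrite -[RHS](unsh0 N (take k w)).
by apply: unsh_ext => I J _ _; rewrite scaler0.
Qed.

Lemma coder_withD N (h1 h2 : seq letter -> N) w :
  coder_with (fun w => h1 w + h2 w) w = coder_with h1 w + coder_with h2 w.
Proof.
rewrite -[coder_with h1 w]scale1r -coder_with_lin.
by apply: coder_with_ext => u x v _ _ _; rewrite scale1r.
Qed.

Lemma coder_withZ N (h : seq letter -> N) c w :
  coder_with (fun w => c *: h w) w = c *: coder_with h w.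
Proof.
rewrite -[RHS]addr0 -(coder_with0 N w) -coder_with_lin.
by apply: coder_with_ext => u x v _ _ _; rewrite addr0.
Qed.

Lemma lin_coder_with (N N' : lmodType K) (F : N -> N') h w : linear F ->
  F (coder_with h w) = coder_with (fun v => F (h v)) w.
Proof.
move=> linF; rewrite lin_sum //; apply: eq_bigr => k _.
by rewrite lin_unsh //; apply: unsh_ext => I J _ _; rewrite linZ.
Qed.

Lemma coder_withE w : coder_with word w = coder_word Q q w.
Proof.
apply: eq_bigr => k _; rewrite -unsh_mask size_take ltn_ord.
by apply: eq_bigr => m _; rewrite scalerA.
Qed.

Hypothesis q_lin : forall u v c l l1 l2, lin_letters c l l1 l2 ->
  lin_letters c (q (u ++ l :: v)) (q (u ++ l1 :: v)) (q (u ++ l2 :: v)).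

Lemma coder_with_multilinear N (h : seq letter -> N) :
  wmultilinear h -> wmultilinear (coder_with h).
Proof.
move=> hh u v; elim/last_ind: v h hh => [|v x IH] h hh c l l1 l2 ll.
  rewrite !cats1 !coder_with_rcons scalerDr [RHS]addrACA -unsh_lin.
  rewrite -coder_with_lin; congr (_ + _).
    by apply: coder_with_ext => u1 s v _ _ _; rewrite -!cats1; apply: hh.
  apply: unsh_ext => I J _ _; rewrite -!cats1 (hh _ _ _ _ _ _ (q_lin _ _ ll)).
  by rewrite scalerDr !scalerA mulrC.
rewrite -!rcons_cons -!rcons_cat !coder_with_rcons scalerDr addrACA.
congr (_ + _).
  apply: IH ll => u1 v1 d y y1 y2 yy.
  by rewrite !rcons_cat !rcons_cons; apply: hh.
apply: unsh_multilinear ll => [J|I] u1 v1 d y y1 y2 yy.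
  have [-> ->] := wdeg_lin u1 v1 yy.
  rewrite !rcons_cat !rcons_cons (hh _ _ _ _ _ _ yy).
  by rewrite scalerDr !scalerA mulrC.
rewrite !rcons_cat !rcons_cons -!cats1 (hh _ _ _ _ _ _ (q_lin _ _ yy)).
by rewrite scalerDr !scalerA mulrC.
Qed.

Hypothesis q_deg : forall w, tag (q w) = wdeg w + Q.

(** The formula is a coderivation for the coproduct that unshuffles the whole
word. By induction on the last letter l, what remains are the terms where q takes
l as its last argument: with s shared out as I, J and the arguments of q
other than l, the value of q stands at the end of the right part or of the left
part. In the first case coassociativity identifies both sides; in the second case
cocommutativity is needed as well, to move the letters that the value of q has
passed. *)
Lemma coder_with_unsh N (h : seq letter -> seq letter -> N) w :
  coder_with (unsh h) w =
  unsh (fun I J => coder_with (fun v => h v J) I +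
                   sgn Q (wdeg I) *: coder_with (h I) J) w.
Proof.
elim/last_ind: w h => [|s l IH] h.
  by rewrite coder_with_nil /= !coder_with_nil scaler0 addr0.
rewrite coder_with_rcons unsh_rcons.
transitivity (coder_with (unsh (fun I J => h I (rcons J l) +
      sgn (wdeg J) (tag l) *: h (rcons I l) J)) s +
    unsh (fun I J => sgn Q (wdeg I) *: unsh (fun I1 I2 =>
      h I1 (rcons I2 (q (rcons J l))) +
      sgn (wdeg I2) (tag (q (rcons J l))) *: h (rcons I1 (q (rcons J l))) I2) I) s).
  congr (_ + _).
    by apply: coder_with_ext => u s1 v _ _ _; rewrite unsh_rcons.
  by apply: unsh_ext => I J _ _; rewrite unsh_rcons.
rewrite IH.
(* The value of q ends the right part in [T1], and the left part in [T2]. *)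
pose T1 I J1 J2 := (sgn Q (wdeg I) * sgn Q (wdeg J1)) *:
  h I (rcons J1 (q (rcons J2 l))).
pose T2 I J1 J2 := (sgn (wdeg J2) (tag l) * sgn Q (wdeg I)) *:
  h (rcons I (q (rcons J1 l))) J2.
transitivity (unsh (fun I J =>
    (coder_with (fun v => h v (rcons J l)) I +
     sgn (wdeg J) (tag l) *: coder_with (fun v => h (rcons v l) J) I +
     sgn Q (wdeg I) *: (coder_with (fun v => h I (rcons v l)) J +
        (sgn Q (tag l) * sgn (wdeg J) (tag l)) *: coder_with (h (rcons I l)) J)))
    s + (unsh (fun I J => unsh (T1 I) J) s + unsh (fun I J => unsh (T2 I) J) s)).
  congr (_ + _).
    apply: unsh_ext => I J _ _; rewrite coder_withD coder_withZ.
    congr (_ + _ *: _); rewrite coder_withD; congr (_ + _).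
    rewrite -coder_withZ; apply: coder_with_ext => u s1 v _ _ dg.
    congr (_ *: _); rewrite -ksignD -dotDl -dg wdeg_cat wdeg_cons q_deg.
    by congr (ksign K (dot _ _)); rewrite -!addrA !(addrCA _ Q).
  (* In [T2] the arguments of q come before the right part, whereas unshuffling
  the result leaves them after it: exchange the two. *)
  rewrite -unshA [X in _ = _ + X](_ : _ = unsh (fun I J =>
    unsh (fun I1 I2 => sgn (wdeg I2) (wdeg J) *: T2 I1 J I2) I) s); last first.
    rewrite (unshA (fun I1 I2 J => sgn (wdeg I2) (wdeg J) *: T2 I1 J I2)).
    by apply: unsh_ext => I J _ _; rewrite unshC.
  rewrite -unshD; apply: unsh_ext => I J _ _; rewrite -unshZ -unshD.
  apply: unsh_ext => I1 I2 _ <-; rewrite scalerDr !scalerA -!ksignD -dotDr.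
  congr (_ + _ *: _); rewrite q_deg wdeg_rcons !dotDr (dotC (wdeg I2) Q).
  rewrite !ksignD; move: (ksign_sqr K (dot Q (wdeg I2))) => sq.
  rewrite -[RHS]mulr1 -sq; ring.
rewrite -(unshA T2) -!unshD; apply: unsh_ext => I J _ _.
rewrite !coder_with_rcons wdeg_rcons dotDr ksignD.
rewrite !scalerDr -!unshZ !scalerA.
rewrite [X in _ + (X + _) = _](_ : _ = unsh (fun J1 J2 => sgn Q (wdeg I) *:
  (sgn Q (wdeg J1) *: h I (rcons J1 (q (rcons J2 l))))) J).
  rewrite [X in _ + (_ + X) = _](_ : _ = unsh (fun I1 I2 => sgn (wdeg J) (tag l) *:
    (sgn Q (wdeg I1) *: h (rcons I1 (q (rcons I2 l))) J)) I).
    rewrite mulrA (mulrC (sgn (wdeg J) _)) -!addrA; congr (_ + _).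
    rewrite addrCA; congr (_ + _); rewrite [RHS]addrCA; congr (_ + _).
    by rewrite addrC -addrA.
  by apply: unsh_ext => I1 I2 _ _; rewrite scalerA.
by apply: unsh_ext => I1 I2 _ _; rewrite scalerA.
Qed.

(** * The coproduct *)
(** The coproduct evaluated with [h]: the last letter is kept at the end of the
right part and the letters before it are unshuffled. The condition that the left
part be nonempty is left to [h], which will vanish there. *)
Definition half_unsh N (h : seq letter -> seq letter -> N) w : N :=
  if w is l :: s then unsh (fun I J => h I (rcons J (last l s))) (belast l s)
  else 0.

Lemma half_unsh_rcons N (h : seq letter -> seq letter -> N) s l :
  half_unsh h (rcons s l) = unsh (fun I J => h I (rcons J l)) s.
Proof. by case: s => [|y s] //=; rewrite belast_rcons last_rcons. Qed.

Lemma half_unsh_multilinear N (h : seq letter -> seq letter -> N) :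
    (forall J, wmultilinear (fun I => h I J)) ->
    (forall I, wmultilinear (h I)) ->
  wmultilinear (half_unsh h).
Proof.
move=> hl hr u v c l l1 l2 ll; case/lastP: v => [|v x].
  rewrite !cats1 !half_unsh_rcons -unsh_lin; apply: unsh_ext => I J _ _.
  by rewrite -!cats1; apply: hr.
rewrite -!rcons_cons -!rcons_cat !half_unsh_rcons.
apply: unsh_multilinear ll => [J|I] u1 v1 d y y1 y2 yy; first exact: hl.
by rewrite !rcons_cat !rcons_cons; apply: hr.
Qed.

Lemma lin_half_unsh (N N' : lmodType K) (F : N -> N') h w : linear F ->
  F (half_unsh h w) = half_unsh (fun I J => F (h I J)) w.
Proof.
by move=> linF; case/lastP: w => [|s l];
   rewrite ?(lin0 linF) // !half_unsh_rcons lin_unsh.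
Qed.

Lemma half_unshD N (h1 h2 : seq letter -> seq letter -> N) w :
  half_unsh (fun I J => h1 I J + h2 I J) w = half_unsh h1 w + half_unsh h2 w.
Proof.
by case/lastP: w => [|s l]; rewrite /= ?addr0 // !half_unsh_rcons unshD.
Qed.

Lemma half_unsh_ext N (h g : seq letter -> seq letter -> N) w :
    (forall I J, J != [::] -> (size I + size J)%N = size w -> h I J = g I J) ->
  half_unsh h w = half_unsh g w.
Proof.
case/lastP: w => [|s l] // hg; rewrite !half_unsh_rcons.
apply: unsh_ext => I J sz _; apply: hg; first by case: (J).
by rewrite !size_rcons addnS sz.
Qed.

(** The coderivation property. The terms in which q does not reach the last
letter are [coder_with_unsh] for the preceding letters; the others match by
coassociativity alone, since the value of q takes over the place of the last
letter. *)
Lemma coder_with_half_unsh N (h : seq letter -> seq letter -> N) w :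
  coder_with (half_unsh h) w =
  half_unsh (fun I J => coder_with (fun v => h v J) I +
                        sgn Q (wdeg I) *: coder_with (h I) J) w.
Proof.
case/lastP: w => [|s l]; first by rewrite coder_with_nil.
rewrite coder_with_rcons half_unsh_rcons.
rewrite (@coder_with_ext _ _ (unsh (fun I J => h I (rcons J l)))) => [|u s1 v _ _ _];
  last by rewrite half_unsh_rcons.
rewrite coder_with_unsh.
rewrite [X in _ + X = _](_ : _ = unsh (fun I J => unsh (fun I1 I2 =>
  (sgn Q (wdeg I1) * sgn Q (wdeg I2)) *: h I1 (rcons I2 (q (rcons J l)))) I) s);
  last first.
  apply: unsh_ext => I J _ _; rewrite half_unsh_rcons -unshZ.
  by apply: unsh_ext => I1 I2 _ <-; rewrite dotDr ksignD.
rewrite (unshA (fun I1 I2 J => (sgn Q (wdeg I1) *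
  sgn Q (wdeg I2)) *: h I1 (rcons I2 (q (rcons J l))))).
rewrite -unshD; apply: unsh_ext => I J _ _.
rewrite coder_with_rcons scalerDr -unshZ addrA; congr (_ + _).
by apply: unsh_ext => I1 I2 _ _; rewrite scalerA.
Qed.

(** Masks without a [true] entry may be added to the sum: their left part is the
empty word, which is zero. *)
Lemma Delta_wordE w :
  Delta_word w = half_unsh (fun I J => tpure (word I) (word J)) w.
Proof.
case: w => //= l s; rewrite -unsh_mask size_belast big_mkcond /=.
apply: eq_bigr => m _; case: ifPn => // nm.
rewrite [mask m _](_ : _ = [::]) ?word_nil; last first.
  apply/eqP; rewrite -size_eq0 size_mask ?size_tuple ?size_belast //.
  by rewrite eqn0Ngt -has_count; apply: contra nm => /hasP[[] // ].
by rewrite (lin0 (tpure_linl _)) scaler0.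
Qed.

Lemma Delta_word_multilinear : wmultilinear (@Delta_word K n W).
Proof.
move=> u v c l l1 l2 ll; rewrite !Delta_wordE.
apply: half_unsh_multilinear ll => [J|I] u1 v1 d y y1 y2 yy.
  by rewrite (word_multilinear _ _ yy) tpure_linl.
by rewrite (word_multilinear _ _ yy) tpure_linr.
Qed.

Lemma Delta_linear : linear (@Delta K n W).
Proof. exact: tlift_linear Delta_word_multilinear. Qed.

Lemma DeltaE w :
  Delta (word w) = half_unsh (fun I J => tpure (word I) (word J)) w.
Proof. by rewrite -Delta_wordE; apply/tlift_word/Delta_word_multilinear. Qed.

Lemma coder_of_linear : linear (coder_of Q q).
Proof.
apply: tlift_linear => [|u v c l l1 l2]; rewrite -?coder_withE.
  exact: coder_with_nil.
by apply/coder_with_multilinear/word_multilinear.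
Qed.

Lemma coder_of_word w : coder_of Q q (word w) = coder_with word w.
Proof.
rewrite coder_withE; apply: tlift_word => [|u v c l l1 l2].
  by rewrite -coder_withE coder_with_nil.
by rewrite -!coder_withE; apply/coder_with_multilinear/word_multilinear.
Qed.

End Coderivations.

(** * Coderivations of the tensor coalgebra *)
Section TensorCoalgebra.
Variables (K : fieldType) (n : nat) (W : gvect K n).
Local Notation letter := (letter W).
Local Notation word := (@word K n W).
Local Notation tcoalg := (tcoalg W).
Local Notation sgn a b := (ksign K (dot a b)).
Implicit Types (u v w s : seq letter) (l : letter) (N : lmodType K).
Implicit Types (P Q al be : 'rV[int]_n) (F G : tcoalg -> tcoalg).
Implicit Types (t x y z : tcoalg).

Lemma thomog_word w : thomog (wdeg w) (word w).
Proof. by apply: lspan_gen; exists w. Qed.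

Lemma degree_sign_multilinear be :
  wmultilinear (fun w => sgn be (wdeg w) *: word w).
Proof.
move=> u v c l l1 l2 ll; rewrite (word_multilinear _ _ ll).
have [-> ->] := wdeg_lin u v ll.
by rewrite scalerDr !scalerA mulrC.
Qed.

Lemma degree_sign_linear be : linear (@degree_sign K n W be).
Proof.
by apply: tlift_linear (degree_sign_multilinear be); rewrite word_nil scaler0.
Qed.

Lemma degree_sign_word be w :
  degree_sign be (word w) = sgn be (wdeg w) *: word w.
Proof.
rewrite /degree_sign tlift_word //; last exact: degree_sign_multilinear.
by rewrite word_nil scaler0.
Qed.

Lemma degree_sign0 t : degree_sign 0 t = t.
Proof.
apply: (tcoalg_ext (G := id)) => [||w] //; first exact: degree_sign_linear.
by rewrite degree_sign_word dotC dot0r scale1r.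
Qed.

Lemma degree_sign_comp P Q t :
  degree_sign P (degree_sign Q t) = degree_sign (P + Q) t.
Proof.
apply: (tcoalg_ext (F := degree_sign P \o degree_sign Q)) => [||w] /=.
- by apply: comp_linear; apply: degree_sign_linear.
- exact: degree_sign_linear.
rewrite !degree_sign_word (linZ (degree_sign_linear _)) degree_sign_word.
by rewrite scalerA dotDl ksignD mulrC.
Qed.

Lemma degree_sign_homog be al t :
  thomog al t -> degree_sign be t = sgn be al *: t.
Proof.
case=> s [Ss ->]; rewrite lin_sum; last exact: degree_sign_linear.
rewrite scaler_sumr !big_seq; apply: eq_bigr => p /Ss [w <- <-].
rewrite (linZ (degree_sign_linear _)) degree_sign_word.
by rewrite !scalerA mulrC.
Qed.

(** A map of weight P changes the degree by P, hence the sign by <P, Q>. *)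
Lemma degree_sign_weight P Q F t : linear F -> has_weight P F ->
  degree_sign Q (F t) = sgn P Q *: F (degree_sign Q t).
Proof.
move=> linF wF.
pose f t := degree_sign Q (F t); pose g t := sgn P Q *: F (degree_sign Q t).
apply: (tcoalg_ext (F := f) (G := g)) => [||w] //; rewrite /f /g.
- exact: comp_linear (degree_sign_linear _) linF.
- move=> c x y; rewrite degree_sign_linear linF scalerDr !scalerA.
  by rewrite [sgn P Q * c]mulrC.
rewrite (degree_sign_homog _ (wF _ _ (thomog_word w))) degree_sign_word linZ //.
by rewrite scalerA dotDr ksignD (dotC Q P) mulrC.
Qed.

Section KTensor.
Variables (F G : tcoalg -> tcoalg) (be : 'rV[int]_n).
Hypotheses (linF : linear F) (linG : linear G).

Lemma ktensor_linear : linear (ktensor F be G).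
Proof.
apply: tensor_map_linear => //.
exact: comp_linear linF (degree_sign_linear _).
Qed.

Lemma ktensor_pure (x y : tcoalg) :
  ktensor F be G (tpure x y) = tpure (F (degree_sign be x)) (G y).
Proof.
apply: tensor_map_pure => //.
exact: comp_linear linF (degree_sign_linear _).
Qed.

End KTensor.

Local Opaque ktensor degree_sign Delta.

(** The coderivation property on a word, with the Koszul signs made explicit. *)
Lemma coderivation_word Q F w : linear F ->
  (Delta (F (word w)) =
     ktensor F 0 id (Delta (word w)) + ktensor id Q F (Delta (word w))) <->
  (Delta (F (word w)) =
   half_unsh (fun I J => tpure (F (word I)) (word J) +
                sgn Q (wdeg I) *: tpure (word I) (F (word J))) w).
Proof.
move=> linF; rewrite DeltaE.
rewrite (lin_half_unsh _ _ (ktensor_linear 0 linF (@id_linear _ _))).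
rewrite (lin_half_unsh _ _ (ktensor_linear Q (@id_linear _ _) linF)) -half_unshD.
suff -> : half_unsh (fun I J => ktensor F 0 id (tpure (word I) (word J)) +
    ktensor id Q F (tpure (word I) (word J))) w =
  half_unsh (fun I J => tpure (F (word I)) (word J) +
     sgn Q (wdeg I) *: tpure (word I) (F (word J))) w by [].
apply: half_unsh_ext => I J _ _; rewrite !ktensor_pure //.
by rewrite degree_sign0 degree_sign_word (linZ (tpure_linl _)).
Qed.

Section CoderOf.
Variables (Q : 'rV[int]_n) (q : seq letter -> letter).
Hypothesis q_lin : forall u v c l l1 l2, lin_letters c l l1 l2 ->
  lin_letters c (q (u ++ l :: v)) (q (u ++ l1 :: v)) (q (u ++ l2 :: v)).
Hypothesis q_deg : forall w, tag (q w) = wdeg w + Q.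

(** Each summand is a word of the expected degree. Working in the quotient by the
span of these words turns this into the vanishing of a sum with zero terms. *)
Lemma coder_of_weight : has_weight Q (coder_of Q q).
Proof.
move=> al; apply: lspan_lin; first exact: coder_of_linear.
move=> _ [w <- <-]; rewrite coder_of_word //; apply/lquot_pi_eq0.
rewrite (lin_coder_with _ _ _ _ (lquot_pi_linear _)).
rewrite -[RHS](coder_with0 Q q _ w); apply: coder_with_ext => u s v _ _ dg.
apply/lquot_pi_eq0/lspan_gen; exists (u ++ q s :: v) => //=.
by rewrite -dg wdeg_cat wdeg_cons q_deg -!addrA (addrC Q).
Qed.

Lemma coder_of_coderivation : coderivation Q (coder_of Q q).
Proof.
have linF := coder_of_linear Q q_lin.
split=> //; first exact: coder_of_weight.
move=> t; set F := coder_of Q q.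
pose f t := Delta (F t).
pose g t := ktensor F 0 id (Delta t) + ktensor id Q F (Delta t).
apply: (tcoalg_ext (F := f) (G := g)) => [||w].
- exact: comp_linear (@Delta_linear _ _ _) linF.
- by apply: add_linear; apply: (comp_linear _ (@Delta_linear _ _ _));
     apply: ktensor_linear.
apply/coderivation_word => //; rewrite /F coder_of_word //.
rewrite (lin_coder_with _ _ _ _ (@Delta_linear _ _ _)).
under coder_with_ext => u s v _ _ _ do rewrite DeltaE.
rewrite coder_with_half_unsh //; apply: half_unsh_ext => I J _ _.
rewrite !coder_of_word //; congr (_ + _ *: _); last first.
  by rewrite (lin_coder_with _ _ _ _ (tpure_linr _)).
by rewrite (lin_coder_with _ _ _ _ (tpure_linl _)).
Qed.

End CoderOf.

(** * Corestrictions determine coderivations *)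
Lemma corestr_multilinear :
  wmultilinear (fun w => if size w == 1%N then word w else 0).
Proof.
move=> u v c l l1 l2 ll; rewrite !size_cat /=.
case: (_ == 1%N); first exact: word_multilinear.
by rewrite scaler0 addr0.
Qed.

Lemma corestr_linear : linear (@corestr K n W).
Proof. exact: tlift_linear corestr_multilinear. Qed.

Lemma corestr_word w : corestr (word w) = if size w == 1%N then word w else 0.
Proof. exact: tlift_word corestr_multilinear _. Qed.

(** The bilinear extension of this function is a partial inverse of the
coproduct. It has to vanish for empty [u], where [word u] is zero although
[word (u ++ v)] is not. *)
Definition append_letter_word v u : tcoalg :=
  if (u != [::]) && (size v == 1%N) then word (u ++ v) else 0.

Lemma append_letter_word_linl v : wmultilinear (append_letter_word v).
Proof.
move=> u1 u2 c l l1 l2 ll; rewrite /append_letter_word.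
have ne (l' : letter) : u1 ++ l' :: u2 != [::] by case: (u1).
rewrite !ne /=; case: (_ == 1%N); last by rewrite scaler0 addr0.
by rewrite -!catA !cat_cons; apply: word_multilinear.
Qed.

Lemma append_letter_word_linr u :
  wmultilinear (fun v => append_letter_word v u).
Proof.
move=> v1 v2 c l l1 l2 ll; rewrite /append_letter_word !size_cat /=.
case: (_ && _); last by rewrite scaler0 addr0.
by rewrite !catA; apply: word_multilinear.
Qed.

(** The extension is made in two steps, first in the left argument and then in
the right one, as words are only linear in each letter. *)
Definition append_letter (p : tcoalg * tcoalg) : tcoalg :=
  tlift (fun v => tlift (append_letter_word v) p.1) p.2.

Lemma tlift_append_linear v : linear (tlift (append_letter_word v)).
Proof. exact: tlift_linear (append_letter_word_linl v). Qed.

Lemma tlift_append_word v u :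
  tlift (append_letter_word v) (word u) = append_letter_word v u.
Proof. by rewrite tlift_word //; apply: append_letter_word_linl. Qed.

Lemma tlift_append_nil t : tlift (append_letter_word [::]) t = 0.
Proof.
apply: (tcoalg_ext (G := fun _ => 0)) => [||w].
- exact: tlift_append_linear.
- by move=> c x y; rewrite scaler0 addr0.
by rewrite tlift_append_word /append_letter_word andbF.
Qed.

Lemma tlift_append_multilinear t :
  wmultilinear (fun v => tlift (append_letter_word v) t).
Proof.
move=> u v c l l1 l2 ll.
apply: (tcoalg_ext (G := fun t => c *: tlift (append_letter_word (u ++ l1 :: v)) t
  + tlift (append_letter_word (u ++ l2 :: v)) t)) => [||w].
- exact: tlift_append_linear.
- move=> d x y; rewrite !tlift_append_linear.
  by rewrite !scalerDr !scalerA addrACA [d * c]mulrC.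
by rewrite !tlift_append_word; apply: append_letter_word_linr.
Qed.

Lemma append_letter_linr x : linear (fun y => append_letter (x, y)).
Proof.
exact: tlift_linear (tlift_append_nil x) (@tlift_append_multilinear x).
Qed.

Lemma append_letter_word_r x v :
  append_letter (x, word v) = tlift (append_letter_word v) x.
Proof.
by rewrite /append_letter tlift_word //;
   [apply: tlift_append_nil | apply: tlift_append_multilinear].
Qed.

Lemma append_letter_linl y : linear (fun x => append_letter (x, y)).
Proof.
move=> c x x'; move: y.
apply: (tcoalg_ext (F := fun y => append_letter (c *: x + x', y))
  (G := fun y => c *: append_letter (x, y) + append_letter (x', y))) => [||w].
- exact: append_letter_linr.
- move=> d y z; rewrite !append_letter_linr.
  by rewrite !scalerDr !scalerA addrACA [d * c]mulrC.
by rewrite !append_letter_word_r tlift_append_linear.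
Qed.

Definition append_tensor : tensor tcoalg tcoalg -> tcoalg := plift append_letter.

Lemma append_tensor_linear : linear append_tensor.
Proof. exact: tensor_lift_linear append_letter_linl append_letter_linr. Qed.

Lemma append_tensor_pure x v :
  append_tensor (tpure x (word v)) = tlift (append_letter_word v) x.
Proof.
rewrite -append_letter_word_r.
exact: tensor_lift_pure append_letter_linl append_letter_linr _ _.
Qed.

(** Every element is recovered from its corestriction and its coproduct: the
term of the coproduct with a single letter on the right determines all tensors
of length at least two. *)
Lemma corestr_append_Delta t :
  t = corestr t + append_tensor (Delta t).
Proof.
apply: (tcoalg_ext (F := id)
  (G := fun t => corestr t + append_tensor (Delta t))) => [||w] //.
  apply: add_linear; first exact: corestr_linear.
  exact: comp_linear append_tensor_linear (@Delta_linear _ _ _).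
rewrite corestr_word DeltaE (lin_half_unsh _ _ append_tensor_linear).
case/lastP: w => [|s l]; first by rewrite word_nil addr0.
rewrite half_unsh_rcons size_rcons eqSS.
transitivity (unsh (fun I J => if J is [::] then
    (if I != [::] then word (rcons I l) else 0) else 0) s
    + (if size s == 0%N then word (rcons s l) else 0)).
  by rewrite unsh_counitr size_eq0; case: (s == [::]); rewrite ?add0r ?addr0.
rewrite addrC; congr (_ + _); apply: unsh_ext => I J _ _.
rewrite append_tensor_pure tlift_append_word /append_letter_word.
rewrite size_rcons eqSS size_eq0.
by case: J => [|l' J] /=; rewrite ?andbT ?andbF ?cats1.
Qed.

(** In the coproduct of a word the left part is nonempty, unless the term is
zero, and so is the right part; both are shorter than the word. Hence by
induction the coproducts of F w and G w agree, and [corestr_append_Delta]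
applies. *)
Lemma coderivation_unique Q F G : coderivation Q F -> coderivation Q G ->
  (forall w, corestr (F (word w)) = corestr (G (word w))) ->
  forall t, F t = G t.
Proof.
move=> [linF _ dF] [linG _ dG] FG; apply: tcoalg_ext => // w.
have [k] := ubnP (size w); elim: k w => // k IH w sw.
rewrite (corestr_append_Delta (F _)) (corestr_append_Delta (G _)) FG.
congr (_ + append_tensor _).
rewrite (iffLR (coderivation_word Q w linF) (dF _)).
rewrite (iffLR (coderivation_word Q w linG) (dG _)).
apply: half_unsh_ext => I J J0 sz; rewrite IH; last first.
  apply: leq_trans (_ : size I < size w)%N _ => //.
  by rewrite -sz -[ltnLHS]addn0 ltn_add2l; case: (J) J0.
case: I sz => [|l I] sz.
  by rewrite word_nil !(lin0 (tpure_linl _)).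
congr (_ + _ *: tpure _ _); apply: IH; rewrite -sz in sw.
by rewrite -ltnS; apply: leq_ltn_trans sw; rewrite addSn ltnS leq_addl.
Qed.

(** * Commutators of coderivations *)
Lemma ktensor_left_comp F G : linear F -> linear G ->
  forall z : tensor tcoalg tcoalg, ktensor F 0 id (ktensor G 0 id z) = ktensor (F \o G) 0 id z.
Proof.
move=> linF linG; have linFG := comp_linear linF linG.
apply: tensor_ext => [||x y]; last by rewrite !ktensor_pure //= !degree_sign0.
  by apply: comp_linear; apply: ktensor_linear.
exact: ktensor_linear.
Qed.

Lemma ktensor_right_comp P Q F G : linear F -> linear G ->
  forall z : tensor tcoalg tcoalg, ktensor id P F (ktensor id Q G z) = ktensor id (Q + P) (F \o G) z.
Proof.
move=> linF linG; have linFG := comp_linear linF linG.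
apply: tensor_ext => [||x y].
- by apply: comp_linear; apply: ktensor_linear.
- exact: ktensor_linear.
by rewrite !ktensor_pure //= degree_sign_comp addrC.
Qed.

(** Maps acting on different tensor factors commute up to the Koszul sign: G on the
right factor sees the degree of the left factor after F has changed it by P. *)
Lemma ktensor_swap P Q F G : linear F -> linear G -> has_weight P F ->
  forall z : tensor tcoalg tcoalg, ktensor id Q G (ktensor F 0 id z) =
            sgn P Q *: ktensor F 0 id (ktensor id Q G z).
Proof.
move=> linF linG wF; apply: tensor_ext => [||x y].
- by apply: comp_linear; apply: ktensor_linear.
- have linS := comp_linear (ktensor_linear 0 linF (@id_linear _ _))
    (ktensor_linear Q (@id_linear _ _) linG).
  by move=> c x y; have /= -> := linS c x y; rewrite scalerDr !scalerA mulrC.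
rewrite !ktensor_pure // !degree_sign0 (degree_sign_weight _ _ linF wF).
by rewrite (linZ (tpure_linl _)).
Qed.

Lemma ktensor_left_comb c F G : linear F -> linear G ->
  forall z : tensor tcoalg tcoalg, ktensor (fun t => F t + c *: G t) 0 id z =
            ktensor F 0 id z + c *: ktensor G 0 id z.
Proof.
move=> linF linG; have linFG := comb_linear c linF linG.
apply: tensor_ext => [||x y]; first exact: ktensor_linear.
  by apply: comb_linear; apply: ktensor_linear.
rewrite !ktensor_pure // degree_sign0.
by rewrite (linD (tpure_linl _)) (linZ (tpure_linl _)).
Qed.

Lemma ktensor_right_comb c Q F G : linear F -> linear G ->
  forall z : tensor tcoalg tcoalg, ktensor id Q (fun t => F t + c *: G t) z =
            ktensor id Q F z + c *: ktensor id Q G z.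
Proof.
move=> linF linG; have linFG := comb_linear c linF linG.
apply: tensor_ext => [||x y]; first exact: ktensor_linear.
  by apply: comb_linear; apply: ktensor_linear.
by rewrite !ktensor_pure // (linD (tpure_linr _)) (linZ (tpure_linr _)).
Qed.

Lemma commutatorE P F Q G :
  commutator P F Q G = fun t => F (G t) + (- sgn P Q) *: G (F t).
Proof. by apply/funext => t; rewrite scaleNr. Qed.

Lemma commutator_linear P F Q G :
  linear F -> linear G -> linear (commutator P F Q G).
Proof.
move=> linF linG; rewrite commutatorE.
exact: comb_linear (comp_linear linF linG) (comp_linear linG linF).
Qed.

(** By [ktensor_swap] the mixed terms of FG and of (-1)^<P, Q> GF coincide, so
only the terms in which both maps act on the same factor remain. *)
Lemma commutator_coderivation P F Q G :
    coderivation P F -> coderivation Q G ->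
  coderivation (P + Q) (commutator P F Q G).
Proof.
move=> [linF wF dF] [linG wG dG].
have linFG := comp_linear linF linG; have linGF := comp_linear linG linF.
split=> [|al t alt|t].
- exact: commutator_linear.
- rewrite commutatorE; apply: lspanD; first by rewrite addrA addrAC; apply/wF/wG.
  by apply: lspanZ; rewrite addrA; apply/wG/wF.
have linD1 := @Delta_linear K n W.
rewrite commutatorE linD // (linZ linD1) !(dF, dG).
have linL f (linf : linear f) := ktensor_linear 0 linf (@id_linear _ tcoalg).
have linR be f (linf : linear f) :=
  ktensor_linear be (@id_linear _ tcoalg) linf.
set z := Delta t.
rewrite (ktensor_left_comb _ linFG linGF) (ktensor_right_comb _ _ linFG linGF).
rewrite !(linD (linL _ linF)) !(linD (linL _ linG)).
rewrite !(linD (linR _ _ linF)) !(linD (linR _ _ linG)).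
rewrite !ktensor_left_comp // !ktensor_right_comp // (ktensor_swap Q linF linG wF).
rewrite (ktensor_swap P linG linF wG) (addrC Q P).
set A1 := ktensor (F \o G) _ _ _; set A2 := ktensor (G \o F) _ _ _.
set B1 := ktensor _ _ (F \o G) _; set B2 := ktensor _ _ (G \o F) _.
set C1 := ktensor F _ _ _; set C2 := ktensor G _ _ _.
rewrite !scalerDr (dotC Q P) scalerA mulNr ksign_sqr scaleN1r scaleNr.
rewrite !scaleNr; exact: cancel_cross_terms.
Qed.

End TensorCoalgebra.

(** * Homogeneous components of length one *)
Section Letters.
Variables (K : fieldType) (n : nat) (W : gvect K n).
Local Notation letter := (letter W).
Local Notation word := (@word K n W).
Local Notation tcoalg := (tcoalg W).
Local Notation sgn a b := (ksign K (dot a b)).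
Implicit Types (u v w s : seq letter) (l : letter) (t : tcoalg).
Implicit Types (Q al be : 'rV[int]_n).

Lemma gcast_linear m (L : gvect K m) a b (e : a = b) : linear (gcast (L := L) e).
Proof. by case: b / e. Qed.

Lemma mkletter_gcast al be (e : al = be) (x : W al) :
  mkletter (gcast e x) = mkletter x.
Proof. by case: be / e. Qed.

Lemma mkletter_tagged l : mkletter (tagged l) = l.
Proof. by case: l. Qed.

(** The arguments can be taken in the degree read off from [l1], which is
convenient when [l1] is an entry of a word and its degree is not a variable. *)
Lemma lin_lettersP c l l1 l2 : lin_letters c l l1 l2 ->
  exists x y : W (tag l1),
    [/\ l = mkletter (c *: x + y), l1 = mkletter x & l2 = mkletter y].
Proof. by case=> al [x [y [-> -> ->]]]; exists x, y. Qed.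

(** Zero on letters of another degree; the choice of the cast does not matter,
because proofs of equality of degrees are unique. *)
Definition letter_at al l : W al :=
  if tag l =P al is ReflectT e then gcast e (tagged l) else 0.

Lemma letter_at_mkletter al (x : W al) : letter_at al (mkletter x) = x.
Proof.
by rewrite /letter_at; case: eqP => // e; rewrite (eq_axiomK e).
Qed.

Lemma mkletter_inj al : injective (@mkletter K n W al).
Proof. by move=> x y /(congr1 (letter_at al)); rewrite !letter_at_mkletter. Qed.

Lemma letter_at_lin al c l l1 l2 : lin_letters c l l1 l2 ->
  letter_at al l = c *: letter_at al l1 + letter_at al l2.
Proof.
case=> be [x [y [-> -> ->]]]; rewrite /letter_at /=.
case: eqP => [e|_]; last by rewrite scaler0 addr0.
exact: gcast_linear.
Qed.

Definition word_at al w : W al := if w is [:: l] then letter_at al l else 0.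

Lemma word_at_multilinear al : wmultilinear (word_at al).
Proof.
move=> [|l' u] [|l'' v] c l l1 l2 ll /=; rewrite ?scaler0 ?addr0 //.
- exact: letter_at_lin.
- by case: u => *; rewrite scaler0 addr0.
by case: u => *; rewrite scaler0 addr0.
Qed.

Definition letter_proj al : tcoalg -> W al := tlift (word_at al).

Lemma letter_proj_linear al : linear (letter_proj al).
Proof. exact: tlift_linear (word_at_multilinear al). Qed.

Lemma letter_proj_word al w : letter_proj al (word w) = word_at al w.
Proof. exact: tlift_word (word_at_multilinear al) _. Qed.

Lemma word1_linear al : linear (fun x : W al => word [:: mkletter x]).
Proof.
by move=> c x y; apply: (@word_multilinear _ _ _ [::] [::]); exists al, x, y.
Qed.

Lemma word1_inj al (x y : W al) :
  word [:: mkletter x] = word [:: mkletter y] -> x = y.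
Proof.
move/(congr1 (letter_proj al)).
by rewrite !letter_proj_word /= !letter_at_mkletter.
Qed.

(** A homogeneous tensor has at most one letter as its component of length one,
namely in its own degree. *)
Lemma corestr_homog al t : thomog al t ->
  corestr t = word [:: mkletter (letter_proj al t)].
Proof.
case=> s [Ss ->].
have lin2 := comp_linear (@word1_linear al) (letter_proj_linear al).
have /= -> := lin_sum lin2.
rewrite (lin_sum (@corestr_linear K n W)) !big_seq; apply: eq_bigr => p /Ss [w wal <-].
have /= -> := linZ lin2.
rewrite (linZ (@corestr_linear K n W)) corestr_word letter_proj_word.
congr (_ *: _); case: w wal => [|l [|l' w]] wal /=.
- by rewrite (lin0 (@word1_linear al)).
- move: wal; rewrite /= /wdeg big_seq1 => e; case: l e => be x /= e.
  by subst al; rewrite letter_at_mkletter.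
by rewrite (lin0 (@word1_linear al)).
Qed.

Lemma mkletter_proj al be t : al = be ->
  mkletter (letter_proj al t) = mkletter (letter_proj be t).
Proof. by move->. Qed.

(** A summand of the coderivation formula is a single letter only if k_1 is the
last letter and the part I is empty. *)
Lemma corestr_coder_of Q (q : seq letter -> letter) s l :
    (forall u v c l l1 l2, lin_letters c l l1 l2 ->
       lin_letters c (q (u ++ l :: v)) (q (u ++ l1 :: v)) (q (u ++ l2 :: v))) ->
  corestr (coder_of Q q (word (rcons s l))) = word [:: q (rcons s l)].
Proof.
move=> q_lin; rewrite coder_of_word //.
rewrite (lin_coder_with _ _ _ _ (@corestr_linear K n W)) coder_with_rcons.
rewrite [X in X + _](_ : _ = 0) ?add0r; last first.
  rewrite -[RHS](coder_with0 Q q _ s); apply: coder_with_ext => u s' v _ _ _.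
  by rewrite corestr_word size_rcons size_cat /= addnS.
rewrite -[RHS](unsh_counitl (fun J => word [:: q (rcons J l)])).
apply: unsh_ext => -[|x I] J _ _; rewrite corestr_word.
  by rewrite wdeg_nil dot0r scale1r.
by rewrite /= size_rcons scaler0.
Qed.

End Letters.

(** * The coderivation of a multilinear map *)
Section Desuspension.
Variables (K : fieldType) (n : nat) (V : gvect K n).
Local Notation dletter := (letter (desusp V)).
Local Notation word := (@word K n (desusp V)).
Local Notation tcoalg := (tcoalg (desusp V)).
Local Notation e1 := (e1 n).
Local Notation sgn a b := (ksign K (dot a b)).
Implicit Types (u v w s : seq dletter) (l : dletter) (t : tcoalg).
Implicit Types (A B be : 'rV[int]_n) (a b : nat).

Lemma gcast_esymK m (L : gvect K m) (d d' : 'rV[int]_m) (e : d = d') (x : L d') :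
  gcast e (gcast (esym e) x) = x.
Proof. by case: d' / e x. Qed.

Lemma downK (l : letter V) : up (down l) = l.
Proof. by rewrite /up /down /= mkletter_gcast mkletter_tagged. Qed.

(** The degrees agree only propositionally, which makes a direct proof awkward;
but [up] is injective, so [downK] suffices. *)
Lemma upK l : down (up l) = l.
Proof.
suff up_inj : injective (@up K n V) by apply: up_inj; rewrite downK.
move=> [be x] [ce y] E.
have tE : be + e1 = ce + e1 by exact: (congr1 tag E).
have bc := addIr _ tE; subst ce; congr Tagged.
exact: (mkletter_inj E).
Qed.

Lemma up_lin c l l1 l2 : lin_letters c l l1 l2 ->
  lin_letters c (up l) (up l1) (up l2).
Proof. by case=> al [x [y [-> -> ->]]]; exists (al + e1), x, y. Qed.

Lemma down_lin c (l l1 l2 : letter V) : lin_letters c l l1 l2 ->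
  lin_letters c (down l) (down l1) (down l2).
Proof.
case=> al [x [y [-> -> ->]]]; set e := esym (subrK e1 al).
exists (al - e1), (gcast e x), (gcast e y); split=> //.
exact: (congr1 (@mkletter K n (desusp V) (al - e1))
  (gcast_linear (L := V) e c x y)).
Qed.

Lemma lscale_lin (W : gvect K n) d c (l l1 l2 : letter W) :
  lin_letters c l l1 l2 ->
  lin_letters c (lscale d l) (lscale d l1) (lscale d l2).
Proof.
case=> al [x [y [-> -> ->]]]; exists al, (d *: x), (d *: y).
by rewrite /lscale /= scalerDr !scalerA mulrC.
Qed.

Lemma up_sign_tags w w' : [seq tag l | l <- w] = [seq tag l | l <- w'] ->
  up_sign w = up_sign w'.
Proof.
elim: w w' => [|l s IH] [|l' s'] //= [-> E]; rewrite (IH _ E).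
by rewrite -(size_map (@tag _ _) s) E size_map.
Qed.

Lemma wdeg_up w : wdeg (map (@up K n V) w) = wdeg w + e1 *+ size w.
Proof.
elim: w => [|l s IH]; first by rewrite !wdeg_nil addr0.
by rewrite /= !wdeg_cons IH mulrS /= addrACA.
Qed.

Section Phi.
Variables (A : 'rV[int]_n) (a : nat).
Local Notation Q := (A + e1 *+ a).
Implicit Types f g : mmap V A a.
Implicit Type al : 'I_a.+1 -> 'rV[int]_n.

(** The form of [mapply] that is free of the degrees computed from the word, so
that the multilinearity of [f] can be used in a fixed family of degrees. *)
Lemma mapply_mkletter f (w : seq (letter V)) al (v : forall i, V (al i)) :
    (forall i : 'I_a.+1, nth (letter0 V) w i = mkletter (v i)) ->
  mapply f w = mkletter (f al v).
Proof.
move=> wv.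
pose app (g : 'I_a.+1 -> letter V) : letter V :=
  mkletter (f (fun i => tag (g i)) (fun i => tagged (g i))).
rewrite -[LHS]/(app (fun i : 'I_a.+1 => nth (letter0 V) w i)).
by rewrite (_ : (fun i : 'I_a.+1 => _) = fun i => mkletter (v i)) //; apply/funext.
Qed.

(** The family of degrees is read off from the word with [l1]; the three words
then differ by the argument at position [size u] only, which [dfwith]
expresses. *)
Lemma mapply_lin f (u v : seq (letter V)) c (l l1 l2 : letter V) :
    (size u + size v)%N = a -> lin_letters c l l1 l2 ->
  lin_letters c (mapply f (u ++ l :: v)) (mapply f (u ++ l1 :: v))
                (mapply f (u ++ l2 :: v)).
Proof.
move=> sz ll.
have ui : (size u < a.+1)%N by rewrite ltnS -sz leq_addr.
pose i0 := Ordinal ui; pose w1 := u ++ l1 :: v.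
pose al (i : 'I_a.+1) := tag (nth (letter0 V) w1 i).
pose v0 (i : 'I_a.+1) : V (al i) := tagged (nth (letter0 V) w1 i).
have n0 (l' : letter V) : nth (letter0 V) (u ++ l' :: v) i0 = l'.
  by rewrite nth_cat ltnn subnn.
have nN (l' : letter V) (i : 'I_a.+1) : i0 != i ->
    nth (letter0 V) (u ++ l' :: v) i = nth (letter0 V) w1 i.
  rewrite -val_eqE /= neq_ltn !nth_cat => /orP[ui'|iu].
    by rewrite ltnNge ltnW //= -(subnKC ui') addSnnS addKn.
  by rewrite iu.
have appE (l' : letter V) (x : V (al i0)) : l' = mkletter x ->
    mapply f (u ++ l' :: v) = mkletter (f al (dfwith v0 x)).
  move=> lx; apply: mapply_mkletter => i.
  by case: dfwithP => [|j ij]; rewrite ?n0 // nN // mkletter_tagged.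
rewrite -(n0 l1) in ll.
have [x [y [lE l1E l2E]]] := lin_lettersP ll.
exists (A + \sum_i al i), (f al (dfwith v0 x)), (f al (dfwith v0 y)).
split; last exact: appE.
  by rewrite (appE _ _ lE) mvalP.
by apply: appE; rewrite -l1E n0.
Qed.

(** The corestriction of [phi f] as a homogeneous function on all words:
[phi_cor f] takes the value 0 in a fixed degree on words of the wrong length. *)
Definition homog_cor f w : dletter :=
  if size w == a.+1 then phi_cor f w else mkletter (0 : desusp V (wdeg w + Q)).

Lemma phi_homog_cor f : phi f = coder_of Q (homog_cor f).
Proof.
congr tlift; apply/funext => w; apply: eq_bigr => k _; apply: eq_bigr => m _ /=.
congr (_ *: _); rewrite /homog_cor; case: ifP => // sz.
rewrite /phi_cor sz.
by rewrite !(multilinear_zero _ _ _ (@word_multilinear _ _ _)).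
Qed.

Lemma homog_cor_tag f w : tag (homog_cor f w) = wdeg w + Q.
Proof.
rewrite /homog_cor; case: eqP => //= sz; rewrite /phi_cor sz eqxx /=.
have -> : \sum_(i < a.+1) tag (nth (letter0 V) (map (@up K n V) w) i) =
    wdeg (map (@up K n V) w).
  by rewrite /wdeg (big_nth (letter0 V)) size_map sz big_mkord.
by rewrite wdeg_up sz mulrSr !addrA addrK (addrC A).
Qed.

Lemma homog_cor_lin f u v c l l1 l2 : lin_letters c l l1 l2 ->
  lin_letters c (homog_cor f (u ++ l :: v)) (homog_cor f (u ++ l1 :: v))
                (homog_cor f (u ++ l2 :: v)).
Proof.
move=> ll; rewrite /homog_cor /phi_cor !size_cat /=; case: eqP => sz; last first.
  have [-> ->] := wdeg_lin u v ll.
  by exists (wdeg (u ++ l :: v) + Q), 0, 0; rewrite scaler0 addr0.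
have [t1 t2] := lin_letters_tag ll.
rewrite (@up_sign_tags (u ++ l1 :: v) (u ++ l :: v)); last by rewrite !map_cat /= t1.
rewrite (@up_sign_tags (u ++ l2 :: v) (u ++ l :: v)); last by rewrite !map_cat /= t2.
rewrite !map_cat /=; apply/lscale_lin/down_lin/mapply_lin; last exact: up_lin.
by move: sz; rewrite !size_map addnS => -[].
Qed.

Lemma phi_coderivation f : coderivation Q (phi f).
Proof.
rewrite phi_homog_cor; apply: coder_of_coderivation.
  exact: homog_cor_lin.
exact: homog_cor_tag.
Qed.

Lemma corestr_phi f w :
  corestr (phi f (word w)) = if size w == a.+1 then word [:: phi_cor f w] else 0.
Proof.
have [linf _ _] := phi_coderivation f.
case/lastP: w => [|s l].
  by rewrite word_nil (lin0 linf) (lin0 (@corestr_linear _ _ _)).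
rewrite phi_homog_cor corestr_coder_of; last exact: homog_cor_lin.
rewrite /homog_cor; case: ifP => // _.
by rewrite (multilinear_zero [::] [::] _ (@word_multilinear _ _ _)).
Qed.

Lemma phi_CoDer f : CoDer Q a.+1 (phi f).
Proof.
split; first exact: phi_coderivation.
by move=> w; rewrite corestr_phi => /negPf ->.
Qed.

(** The word on which a coderivation is evaluated to read off the value at [v] of
its multilinear map. *)
Definition down_word al (v : forall i : 'I_a.+1, V (al i)) : seq dletter :=
  [seq down (mkletter (v i)) | i <- enum 'I_a.+1].

Lemma size_down_word al (v : forall i : 'I_a.+1, V (al i)) :
  size (down_word v) = a.+1.
Proof. by rewrite size_map size_enum_ord. Qed.

(** The sign in [phi_cor]. *)
Definition up_shift w : K := ksign K ((a * a.+1)./2%N%:Z + up_sign w).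

Lemma up_down_word al (v : forall i : 'I_a.+1, V (al i)) (i : 'I_a.+1) :
  nth (letter0 V) (map (@up K n V) (down_word v)) i = mkletter (v i).
Proof.
rewrite -map_comp (nth_map i) ?size_enum_ord //= downK.
by rewrite nth_ord_enum.
Qed.

Lemma phi_cor_down_word f al (v : forall i, V (al i)) :
  phi_cor f (down_word v) =
  lscale (up_shift (down_word v)) (down (mkletter (f al v))).
Proof.
rewrite /phi_cor size_down_word eqxx; congr (lscale _ (down _)).
by apply: mapply_mkletter => i; apply: up_down_word.
Qed.

(** The corestriction of [phi f] on [down_word v] is [f al v] up to sign and
desuspension. *)
Lemma phi_inj : injective (fun f => phi f).
Proof.
move=> f g fg; apply: mmapP => al v.
have /= := congr1 (fun F => corestr (F (word (down_word v)))) fg.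
rewrite !corestr_phi size_down_word eqxx !phi_cor_down_word.
move/word1_inj => /(congr1 ( *:%R (up_shift (down_word v)))); rewrite !ksignK /=.
by move/(congr1 (gcast (subrK e1 _))); rewrite !gcast_esymK.
Qed.

Section Surjectivity.
Variable F : tcoalg -> tcoalg.
Hypothesis derF : coderivation Q F.
Hypothesis corF : forall w, size w != a.+1 -> corestr (F (word w)) = 0.

(** The inverse of the formula for [phi_cor]: the sign is its own inverse, and the
cast is the suspension of a letter of degree [A + \sum_i al i - e1]. *)
Definition phi_preim_val : forall al : 'I_a.+1 -> 'rV[int]_n,
    (forall i, V (al i)) -> V (A + \sum_i al i) :=
  fun al (v : forall i, V (al i)) => gcast (subrK e1 (A + \sum_i al i))
    (up_shift (down_word v) *:
       letter_proj (A + \sum_i al i - e1) (F (word (down_word v)))).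

(** Replacing the argument at i changes exactly one letter of [down_word v]. *)
Lemma phi_preim_multilinear : multilinear phi_preim_val.
Proof.
move=> al v i c x y; rewrite /phi_preim_val.
have [e [e' [enumE ie ie']]] : exists e e',
    [/\ enum 'I_a.+1 = e ++ i :: e', i \notin e & i \notin e'].
  have := mem_enum 'I_a.+1 i; rewrite inE => ei.
  have := enum_uniq 'I_a.+1; case/splitPr: ei => e e'.
  rewrite cat_uniq /= negb_or => /and4P[_ /andP[ie _] ie' _].
  by exists e, e'.
pose u := [seq down (mkletter (v j)) | j <- e].
pose u' := [seq down (mkletter (v j)) | j <- e'].
have dwE (z : V (al i)) : down_word (dfwith v z) = u ++ down (mkletter z) :: u'.
  rewrite /down_word enumE map_cat map_cons. rewrite dfwith_in; congr (_ ++ _ :: _).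
    apply/eq_in_map => j je; rewrite dfwith_out //.
    by apply: contraNneq ie => ->.
  apply/eq_in_map => j je; rewrite dfwith_out //.
  by apply: contraNneq ie' => ->.
rewrite !dwE.
have ll : lin_letters c (down (mkletter (c *: x + y))) (down (mkletter x))
    (down (mkletter y)).
  by apply: down_lin; exists (al i), x, y.
have shiftE (z : V (al i)) : up_shift (u ++ down (mkletter z) :: u') =
    up_shift (u ++ down (mkletter x) :: u').
  by rewrite /up_shift (@up_sign_tags _ (u ++ down (mkletter x) :: u')) ?map_cat.
rewrite (shiftE (_ + _)) (shiftE y) (word_multilinear _ _ ll).
have [linF _ _] := derF.
rewrite linF letter_proj_linear scalerDr scalerA mulrC -scalerA.
exact: gcast_linear.
Qed.

Definition phi_preim : mmap V A a := Mmap phi_preim_multilinear.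

(** Coderivations with equal corestrictions are equal, and F t is homogeneous on
words, so that its corestriction is the letter from which [phi_preim_val] is
computed. *)
Lemma phi_preimK t : phi phi_preim t = F t.
Proof.
apply: (coderivation_unique (phi_coderivation _) derF) => w.
have [_ wF _] := derF.
rewrite corestr_phi; case: eqP => [sz|/eqP /corF //].
rewrite (corestr_homog (wF _ _ (thomog_word w))); congr (word [:: _]).
pose v (i : 'I_a.+1) := tagged (nth (letter0 V) (map (@up K n V) w) i).
have wE : w = down_word v.
  apply: (inj_map (can_inj upK)); apply: (@eq_from_nth _ (letter0 V)).
    by rewrite !(size_map (@up K n V)) size_down_word.
  move=> i; rewrite size_map sz => ia.
  by rewrite (up_down_word v (Ordinal ia)) mkletter_tagged.
set be := A + \sum_(i < a.+1) tag (nth (letter0 V) (map (@up K n V) w) i) - e1.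
have corE : phi_cor phi_preim w = mkletter (letter_proj be (F (word w))).
  rewrite [in LHS]wE phi_cor_down_word /= /phi_preim_val -wE mkletter_gcast.
  rewrite -[mkletter _]/(up (@mkletter K n (desusp V) be
    (up_shift w *: letter_proj be (F (word w))))) upK.
  by rewrite /lscale /= ksignK.
rewrite corE; apply: mkletter_proj; rewrite -(homog_cor_tag phi_preim).
by rewrite /homog_cor sz eqxx corE.
Qed.

End Surjectivity.

Lemma phi_bij : set_bij setT (CoDer Q a.+1) (@phi K n V A a).
Proof.
split.
- by move=> f _; apply: phi_CoDer.
- by move=> f g _ _; apply: phi_inj.
move=> F [derF corF]; exists (phi_preim derF) => //.
by apply/funext => t; apply: phi_preimK.
Qed.

Lemma phi_linear c f g t : phi (c *: f + g) t = c *: phi f t + phi g t.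
Proof.
have [lin1 _ _] := phi_coderivation (c *: f + g).
have [linf _ _] := phi_coderivation f.
have [ling _ _] := phi_coderivation g.
apply: (tcoalg_ext (G := fun t => c *: phi f t + phi g t)) => [||w] //.
  move=> d x y; rewrite linf ling !scalerDr !scalerA addrACA.
  by rewrite [d * c]mulrC.
have homog_lin s : lin_letters c (homog_cor (c *: f + g) s) (homog_cor f s)
    (homog_cor g s).
  rewrite /homog_cor /phi_cor; case: eqP => sz; last first.
    by exists (wdeg s + Q), 0, 0; rewrite scaler0 addr0.
  apply/lscale_lin/down_lin; eexists; eexists; eexists; split; reflexivity.
have wordE h : phi h (word w) = coder_with Q (homog_cor h) word w.
  by rewrite phi_homog_cor coder_of_word //; apply: homog_cor_lin.
rewrite !wordE /coder_with scaler_sumr -big_split /=; apply: eq_bigr => k _.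
rewrite -unsh_lin; apply: unsh_ext => I J _ _.
by rewrite (word_multilinear _ _ (homog_lin _)) scalerDr !scalerA mulrC.
Qed.

End Phi.
End Desuspension.

(** * The bracket *)
Section Bracket.
Variables (K : fieldType) (n : nat) (V : gvect K n).
Hypothesis n_gt0 : (0 < n)%N.
Local Notation word := (@word K n (desusp V)).
Local Notation tcoalg := (tcoalg (desusp V)).
Local Notation e1 := (e1 n).
Local Notation sgn a b := (ksign K (dot a b)).

(** [phi g] replaces b + 1 letters by one, so it shortens words by b. A single
letter results from [phi f] only on words of a + 1 letters. *)
Lemma corestr_phi_phi (A B : 'rV[int]_n) (a b : nat) (f : mmap V A a)
    (g : mmap V B b) w : size w != (a + b).+1 ->
  corestr (phi f (phi g (word w))) = 0.
Proof.
move=> sw; have [linf _ _] := phi_coderivation f.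
rewrite [phi g]phi_homog_cor coder_of_word; last exact: homog_cor_lin.
have linC := comp_linear (@corestr_linear _ _ _) linf.
have /= -> := lin_coder_with (B + e1 *+ b) (homog_cor g) word w linC.
rewrite -[RHS](coder_with0 (B + e1 *+ b) (homog_cor g) _ w).
apply: coder_with_ext => u s v _ sz _.
have [sb|sb] := eqVneq (size s) b.+1.
  rewrite corestr_phi size_cat /=; case: eqP => // sa.
  by case/eqP: sw; rewrite -sz sb -addSn -sa addnAC addnS -addSn addnS addSn -addnS.
rewrite /homog_cor (negPf sb) (multilinear_zero _ _ _ (@word_multilinear _ _ _)).
exact: (lin0 linC).
Qed.

Lemma commutator_phi (A B : 'rV[int]_n) (a b : nat) (f : mmap V A a)
    (g : mmap V B b) :
  CoDer ((A + B) + e1 *+ (a + b)) (a + b).+1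
    (commutator (A + e1 *+ a) (phi f) (B + e1 *+ b) (phi g)).
Proof.
split.
  rewrite mulrnDr addrACA.
  by apply: commutator_coderivation; apply: phi_coderivation.
move=> w sw; rewrite /commutator (linB (@corestr_linear _ _ _)).
rewrite (linZ (@corestr_linear _ _ _)) !corestr_phi_phi ?scaler0 ?subrr //.
by rewrite addnC.
Qed.

Lemma phiz_linear (A : 'rV[int]_n) (a : int) t :
  linear (fun f : Mz V A a => phiz f t).
Proof.
case: a => [a|a] c f g; first exact: phi_linear.
by rewrite /= scaler0 addr0.
Qed.

Lemma phiz_inj (A : 'rV[int]_n) (a : int) :
  injective (@phiz K n V A a).
Proof.
case: a => a f g; first exact: phi_inj.
by move=> _; rewrite (thinmx0 f) (thinmx0 g).
Qed.

Lemma phiz_is_linear (A : 'rV[int]_n) (a : int) (f : Mz V A a) :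
  linear (phiz f).
Proof.
case: a f => [a|a] f; first by have [] := phi_coderivation f.
by move=> c x y; rewrite /= scaler0 addr0.
Qed.

Lemma commutator0r P F Q (t : tcoalg) : linear F ->
  commutator P F Q (fun _ => 0) t = 0.
Proof. by move=> linF; rewrite /commutator (lin0 linF) scaler0 subr0. Qed.

Lemma commutator0l P Q G (t : tcoalg) : linear G ->
  commutator P (fun _ => 0) Q G t = 0.
Proof. by move=> linG; rewrite /commutator (lin0 linG) scaler0 subr0. Qed.

(** The degree of the bracket is a sum of degrees only propositionally, whence C
and c. When a or b is negative the commutator is zero. *)
Lemma phiz_commutator (A B C : 'rV[int]_n) (a b c : int) (f : Mz V A a)
    (g : Mz V B b) : C = A + B -> c = a + b ->
  exists h : Mz V C c,
    phiz h = commutator (A + e1 *~ a) (phiz f) (B + e1 *~ b) (phiz g).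
Proof.
have phi0 D d : @phiz K n V D d 0 = 0.
  by apply/funext => t; apply: (lin0 (@phiz_linear D d t)).
case: a f => a f; case: b g => b g -> ->; last 3 first.
- by exists 0; rewrite phi0; apply/funext => t;
     rewrite [RHS](commutator0r _ _ _ (phiz_is_linear (a := a) f)).
- by exists 0; rewrite phi0; apply/funext => t;
     rewrite [RHS](commutator0l _ _ _ (phiz_is_linear (a := b) g)).
- by exists 0; rewrite phi0; apply/funext => t;
     rewrite [RHS](commutator0l _ _ _ (phiz_is_linear (a := Negz b) g)).
rewrite -PoszD.
have [_ _ /(_ _ (commutator_phi f g)) [h _ hE]] := phi_bij V (A + B) (a + b).
by exists h.
Qed.

Lemma phiz_gcast (d d' : 'rV[int]_(n + 1)) (e : d = d') (x : Mr V d) :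
  phiz (gcast e x : Mr V d') = phiz x.
Proof. by case: d' / e. Qed.

Implicit Types d : 'rV[int]_(n + 1).

(** The weight of the coderivation of an element of degree [d]. *)
Definition coder_deg d : 'rV[int]_n := wt d + e1 *~ ar d.

Lemma wtD d d' : wt (d + d') = wt d + wt d'.
Proof. exact: raddfD. Qed.

Lemma arD d d' : ar (d + d') = ar d + ar d'.
Proof. by rewrite /ar !mxE. Qed.

Lemma coder_degD d d' : coder_deg (d + d') = coder_deg d + coder_deg d'.
Proof. by rewrite /coder_deg wtD arD mulrzDr addrACA. Qed.

Lemma dot_e1 : dot e1 e1 = 1.
Proof.
rewrite /dot (bigD1 (Ordinal n_gt0)) //= big1 ?mxE ?mulr1 ?addr0 // => i.
by rewrite -val_eqE /= !mxE => /negPf ->; rewrite mulr0.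
Qed.

Lemma dot_split d d' : dot d d' = dot (wt d) (wt d') + ar d * ar d'.
Proof.
rewrite /dot big_split_ord big_ord1; congr (_ + _).
  by apply: eq_bigr => i _; rewrite !mxE.
by rewrite /ar !mxE.
Qed.

(** Up to the factor -1, the sign by which the bracket differs from the
commutator: the vector b e1 + B in its definition is [coder_deg d'], which is
additive, so the sign is bimultiplicative. *)
Definition twist d d' : K := sgn (e1 *~ ar d) (coder_deg d').

Lemma twistDl d1 d2 d : twist (d1 + d2) d = twist d1 d * twist d2 d.
Proof. by rewrite /twist arD mulrzDr dotDl ksignD. Qed.

Lemma twistDr d1 d2 d : twist d (d1 + d2) = twist d d1 * twist d d2.
Proof. by rewrite /twist coder_degD dotDr ksignD. Qed.

Lemma twist_sqr d d' : twist d d' * twist d d' = 1.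
Proof. exact: ksign_sqr. Qed.

(** The sign that defines the bracket turns the grading of coderivations into
the bigrading of multilinear maps. *)
Lemma twist_sign d d' :
  sgn d d' = sgn (coder_deg d) (coder_deg d') * twist d d' * twist d' d.
Proof.
rewrite /twist /coder_deg -!ksignD dot_split !dotDl !dotDr !dotMzl.
rewrite !(dotC _ (e1 *~ _)) !dotMzl dot_e1.
set x := dot e1 (wt d'); set y := dot e1 (wt d).
set p := ar d; set q := ar d'; set r := dot (wt d) (wt d').
rewrite (_ : r + _ + _ + _ + _ = (r + p * q) + ((q * y + p * x + p * q) + (q * y + p * x + p * q))).
  by rewrite [RHS]ksignD [ksign K (_ + _ + _ + _)]ksignD ksign_sqr mulr1.
ring.
Qed.

(** The commutator lies in the image of [phi], where [phiz_inv] is a section. *)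
Lemma phiz_bracket d d' (f : Mr V d) (g : Mr V d') t :
  phiz (Mr_bracket f g) t =
  - (twist d d' *: commutator (coder_deg d) (phiz f) (coder_deg d') (phiz g) t).
Proof.
rewrite /Mr_bracket; set h := phiz_inv _ _ _.
have /= -> := linZ (@phiz_linear (wt (d + d')) (ar (d + d')) t).
rewrite [_ + wt d']addrC ksignD ksign1 mulN1r scaleNr; congr (- (_ *: _)).
suff -> : phiz h = commutator (coder_deg d) (phiz f) (coder_deg d') (phiz g).
  by [].
have /(xgetPex 0) := phiz_commutator f g (wtD d d') (arD d d').
by [].
Qed.

Lemma twisted_commutator_lin (N : lmodType K) (x1 x2 y1 y2 : N) (c p s : K) :
  - (p *: (c *: x1 + x2 - s *: (c *: y1 + y2))) =
  c *: - (p *: (x1 - s *: y1)) - p *: (x2 - s *: y2).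
Proof.
rewrite scalerN -opprD scalerA mulrC -scalerA -scalerDr; congr (- (_ *: _)).
by rewrite scalerBr scalerDr !scalerA (mulrC s) opprD addrACA.
Qed.

(** Nested brackets: the two factors -1 cancel. *)
Lemma twist_twist (N : lmodType K) (x y : N) (p q s : K) :
  - (p *: (- (q *: x) - s *: - (q *: y))) = (p * q) *: (x - s *: y).
Proof.
rewrite [s *: - _]scalerN opprK (scalerA s) (mulrC s) -(scalerA q s) addrC.
by rewrite -scalerBr scalerA -scalerN opprB.
Qed.

(** Here s is the sign of the commutator, p and q are the twists of the two
orders, and s p q is the sign of the bigrading by [twist_sign]. *)
Lemma commutator_antisym (N : lmodType K) (x y : N) (s p q : K) :
  s * s = 1 -> q * q = 1 ->
  - (p *: (x - s *: y)) = - ((s * p * q) *: - (q *: (y - s *: x))).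
Proof.
move=> s2 q2; rewrite scalerN opprK !scalerBr !scalerA opprB.
congr (_ *: _ - _ *: _); first by rewrite -(mulrA _ q q) q2 mulr1 mulrC.
by rewrite -(mulrA _ q q) q2 mulr1 mulrAC s2 mul1r.
Qed.

(** The Jacobi identity for graded commutators of F, G, H: the x_i are the values
of FGH, FHG, GHF, HGF, GFH and HFG, the signs p, q, r belong to the pairs
(F, G), (F, H), (G, H), and c is the common product of twists. *)
Lemma commutator_jacobi (N : lmodType K) (x1 x2 x3 x4 x5 x6 : N) (c p q r : K) :
  p * p = 1 ->
  c *: ((x1 - r *: x2) - (p * q) *: (x3 - r *: x4)) =
  c *: ((x1 - p *: x5) - (q * r) *: (x6 - p *: x4)) +
  (c * p) *: ((x5 - q *: x3) - (p * r) *: (x2 - q *: x6)).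
Proof.
move=> p2; rewrite -[(c * p) *: _]scalerA -scalerDr; congr (_ *: _).
rewrite !scalerBr !scalerA !mulrA p2 mul1r.
rewrite (_ : q * r * p = p * q * r); last by ring.
rewrite (mulrC r q) !opprB.
set a := r *: x2; set b := (p * q) *: x3; set y := (p * q * r) *: x4.
set d := p *: x5; set e := (q * r) *: x6.
rewrite (addrACA (x1 - d)) subrKA.
by rewrite subrKA addrACA [RHS]addrACA [- a - b]addrC.
Qed.

(** [phiz] is injective, and insensitive to [gcast], so the axioms may be checked
on coderivations. *)
Lemma Mr_bracket_graded_lie : graded_lie (@Mr_bracket K n V).
Proof.
have phizL d t := @phiz_linear (wt d) (ar d) t.
have lin d (f : Mr V d) := @phiz_is_linear (wt d) (ar d) f.
split.
- move=> d d' g c f1 f2; apply: phiz_inj; apply/funext => t.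
  rewrite (phizL (d + d') t) !phiz_bracket /commutator.
  rewrite !(phizL d) (linD (lin _ g)) (linZ (lin _ g)).
  exact: twisted_commutator_lin.
- move=> d d' f c g1 g2; apply: phiz_inj; apply/funext => t.
  rewrite (phizL (d + d') t) !phiz_bracket /commutator.
  rewrite !(phizL d') (linD (lin _ f)) (linZ (lin _ f)).
  exact: twisted_commutator_lin.
- move=> d d' f g; apply: phiz_inj; apply/funext => t.
  rewrite (linN (phizL (d + d') t)) (linZ (phizL (d + d') t) (sgn d d')).
  rewrite phiz_gcast.
  rewrite !phiz_bracket /commutator (dotC (coder_deg d')).
  rewrite twist_sign; apply: commutator_antisym; first exact: ksign_sqr.
  exact: twist_sqr.
move=> d1 d2 d3 f g h; apply: phiz_inj; apply/funext => t.
rewrite (linD (phizL (d1 + (d2 + d3)) t)) (linZ (phizL (d1 + (d2 + d3)) t) (sgn d1 d2)).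
rewrite !phiz_gcast !phiz_bracket /commutator !phiz_bracket /commutator.
rewrite !(linN (lin _ f), linZ (lin _ f), linB (lin _ f)).
rewrite !(linN (lin _ g), linZ (lin _ g), linB (lin _ g)).
rewrite !(linN (lin _ h), linZ (lin _ h), linB (lin _ h)).
rewrite !twist_twist !twistDl !twistDr.
have degDl d d' d'' : sgn (coder_deg (d + d')) (coder_deg d'') =
    sgn (coder_deg d) (coder_deg d'') * sgn (coder_deg d') (coder_deg d'').
  by rewrite coder_degD dotDl ksignD.
have degDr d d' d'' : sgn (coder_deg d) (coder_deg (d' + d'')) =
    sgn (coder_deg d) (coder_deg d') * sgn (coder_deg d) (coder_deg d'').
  by rewrite coder_degD dotDr ksignD.
rewrite !degDl !degDr; rewrite (dotC (coder_deg d2) (coder_deg d1)).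
(* The product of twists common to the three double brackets. *)
set c0 := twist d1 d2 * twist d1 d3 * twist d2 d3.
rewrite scalerA (_ : sgn d1 d2 * _ = c0 * sgn (coder_deg d1) (coder_deg d2));
  last first.
  rewrite twist_sign /c0; have sq := twist_sqr d2 d1.
  by rewrite -[RHS]mulr1 -sq; ring.
have -> : twist d1 d3 * twist d2 d3 * twist d1 d2 = c0 by rewrite /c0; ring.
by apply: commutator_jacobi; apply: ksign_sqr.
Qed.

End Bracket.

Theorem theorem2 (K : fieldType) (charK : [pchar K] =i pred0)
    (n : nat) (n_gt0 : (0 < n)%N) (V : gvect K n) :
  [/\ (forall (A : 'rV[int]_n) (a : nat),
         set_bij setT (CoDer (A + e1 n *+ a) a.+1) (@phi K n V A a)),
      (forall (A B : 'rV[int]_n) (a b : nat) (f : mmap V A a) (g : mmap V B b),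
         CoDer ((A + B) + e1 n *+ (a + b)) (a + b).+1
           (commutator (A + e1 n *+ a) (phi f) (B + e1 n *+ b) (phi g))) &
      graded_lie (@Mr_bracket K n V)].
Proof.
split.
- by move=> A a; apply: phi_bij.
- by move=> A B a b f g; apply: commutator_phi.
exact: Mr_bracket_graded_lie.
Qed.
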